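(* Let $k$ be a field, $Q$ a finite quiver, $R=kQ$, $I$ a two-sided ideal of $R$ and $\Lambda=R/I$. Let $M$ be a right $\Lambda$-module which is finitely presented as a right $R$-module. Suppose that there is an admissible order $>$ on the set $\mathcal B$ of paths of $Q$ such that $I$ has a finite Gröbner basis with respect to $>$. Then there is an admissible presentation $$0\to \Big(\coprod_{i\in T_1} f^1_iR\Big)\amalg\Big(\coprod_{j\in U_1} {f^1_j}'R\Big)\xrightarrow{H^1}\coprod_{i\in T_0} f^0_iR\xrightarrow{\pi} M\to 0$$ of $M$ over $R$ such that the projective $\Lambda$-resolution $(\mathbb L,e)$ of $M$ associated to it has the property that each $L^n$ $(n\ge0)$ is a finitely generated $\Lambda$-module.
   Context: Path algebra. $Q_0$ is the vertex set of $Q$; $\mathcal B$ is the set of finite directed paths (vertices are paths of length $0$) and is a $k$-basis of $R=kQ$; $pq$ is the concatenation ($p$ followed by $q$) if the terminus of $p$ is the origin of $q$, and $0$ otherwise. A nonzero element $x$ of a right $R$-module is right uniform if $x=xv$ for some $v\in Q_0$; a nonzero $x\in R$ is uniform if $x=uxv$ for some $u,v\in Q_0$. Admissible order: a well-order $>$ on $\mathcal B$ such that $p>q$ implies $pr>qr$ whenever $pr,qr\neq0$, and $rp>rq$ whenever $rp,rq\ne 0$; and $p=qr$ (all paths) implies $p\ge q$ and $p\ge r$. For $0\ne x\in R$, $\operatorname{tip}(x)$ is the largest path occurring in $x$. A subset $\mathcal G\subseteq I$ is a Gröbner basis of $I$ if the tips of its nonzero elements and the tips of all nonzero elements of $I$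 generate the same ideal. For paths, $p\mid q$ means $q=rps$, $p\mid_l q$ means $q=ps$, $p\mid_r q$ means $q=rp$. A set $X\subseteq R\setminus\{0\}$ is tip-reduced if $x,y\in X$, $\operatorname{tip}(x)\mid\operatorname{tip}(y)$ imply $x=y$. Fix a tip-reduced Gröbner basis $\mathcal G$ of $I$ consisting of uniform elements. Tips in direct sums. For right uniform $f_i\in R$ $(i\in T)$ with $f_iv_i=f_i$, $v_i\in Q_0$, the module $\coprod_{i\in T} f_iR$ (external direct sum) has $k$-basis the elements $f_ip$ placed in coordinate $i$ ($p$ a path with origin $v_i$), because $v_iR\cong f_iR$. Given a total order on this basis, the tip of a nonzero element $w$ is the largest basis element occurring in $w$; if it is $f_ip$ then $\operatorname{tippath}(w)=p$, $\operatorname{tipcoord}(w)=i$. $f_ip$ left divides $f_jq$ iff $i=j$ and $p\mid_lq$. A set of nonzero right uniform elements is right tip-reduced if no tip of an element left divides the tip of a different element. Admissible presentation of $M$ over $R$: an exact sequence of right $R$-modules as displayed in the claim with $H^1$ an inclusion, $f^0_i\in R$ and $f^1_i,{f^1_j}'\in\coprod_{i\in T_0}f^0_iR$ right uniform, each ${f^1_j}'\in\coprod_{i\in T_0}f^0_iI$, and $\{f^1_i\}\cup\{{f^1_j}'\}$ right tip-reduced, where $T_0$ is well-ordered and the basis of $\coprod_{T_0} f^0_iR$ is ordered by: $f^0_ip>f^0_jq$ iff $p>q$, or $p=q$ and $i>j$. The sets $O(p),N(p)$. For a path $p$, $X(p)$ is the set of paths $q$ with (1) $p\mid_lq$; (2)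 $\operatorname{tip}(g)\mid_rq$ for some $g\in\mathcal G$; (3) if $q=r\operatorname{tip}(g')s$ with paths $r,s$ and $g'\in\mathcal G$, then $s$ is a vertex (hence $g'=g$). $g$ is the end relation of $q$; write $q=q'\operatorname{tip}(g)$. $O(p)=\{q\in X(p):\operatorname{length}(q')<\operatorname{length}(p)\}$, $N(p)=X(p)\setminus O(p)$. Associated resolution. Define recursively, for $n\ge1$, $T_{n+1},U_{n+1}$, $f^{n+1}_s$, ${f^{n+1}_s}'$ as follows. Given right uniform $f^n_i$ $(i\in T_n)$, ${f^n_j}'$ $(j\in U_n)$ in $\coprod_{T_{n-1}}f^{n-1}_iR$ (with its ordered basis), put $T_{n+1}=\{(i,q):i\in T_n,q\in O(\operatorname{tippath}(f^n_i))\}$ and $U_{n+1}=\{(i,q):i\in T_n,q\in N(\operatorname{tippath}(f^n_i))\}$. For $s=(i,q)\in T_{n+1}$ with end relation $g$, $q=\operatorname{tippath}(f^n_i)p=q'\operatorname{tip}(g)$, $i^*=\operatorname{tipcoord}(f^n_i)$ and $c\in k$ the coefficient of the tip of $f^n_i$ divided by that of $g$, the element $f^n_ip-f^{n-1}_{i^*}cq'g$ is uniquely $\sum_{l\in T_n}f^n_lr_l+\sum_{l\in U_n}{f^n_l}'s_l$; set $f^{n+1}_s=f^n_ip-\sum_{l\in T_n}f^n_lr_l$. For $s=(i,q)\in U_{n+1}$ with end relation $g$ and $q=\operatorname{tippath}(f^n_i)z\operatorname{tip}(g)$, set ${f^{n+1}_s}'=f^n_izg$. The basis $\{f^n_ip\}$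 of $\coprod_{T_n}f^n_iR$ is ordered by comparing the tips of the $f^n_ip$ in $\coprod_{T_{n-1}}f^{n-1}_iR$. This construction satisfies: $\{f^n_i\}\cup\{{f^n_j}'\}$ is right tip-reduced, ${f^n_j}'\in\coprod_{T_{n-1}} f^{n-1}_iI$, and for $n\ge2$, $(\coprod_{T_{n-1}} f^{n-1}_iR)\cap(\coprod_{T_{n-2}} f^{n-2}_iI)=(\coprod_{T_n} f^n_iR)\amalg(\coprod_{U_n} {f^n_j}'R)$. The associated resolution $(\mathbb L,e)$: $L^n=\coprod_{i\in T_n}f^n_iR/\coprod_{i\in T_n}f^n_iI$; if $f^n_i=\sum_{j\in T_{n-1}}f^{n-1}_jh_{ji}$ with $h_{ji}\in R$, then $e^n:L^n\to L^{n-1}$ sends the class of the $i$-th generator to the element whose $j$-th component is the class of $f^{n-1}_jh_{ji}$; $L^0\to M$ is induced by $\pi$. If $f^n_iv^n_i=f^n_i$ with $v^n_i\in Q_0$, then $L^n\cong\coprod_{i\in T_n}v^n_i\Lambda$. *)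

(* Defs.v *)
From HB Require Import structures.
From mathcomp Require Import all_boot all_order all_algebra.
From mathcomp Require Import generic_quotient ring_quotient.
From mathcomp Require Import finmap.
From mathcomp.multinomials Require Import monalg.
From mathcomp Require Import boolp classical_sets cardinality wochoice.

Set Implicit Arguments.
Unset Strict Implicit.
Unset Printing Implicit Defensive.

Import GRing.Theory.

Local Open Scope ring_scope.
Local Open Scope quotient_scope.

(* A right module over A is a left module over the converse ring A^c: the
   action of r on x is [(r : A^c) *: x], written [x ** r]. *)
Definition ract (A : pzRingType) (N : lmodType A^c) (x : N) (r : A) : N :=
  (r : A^c) *: x.
Notation "x ** r" := (ract x r) (at level 40, left associativity).

Section ModuleNotions.
Variable A : pzRingType.

Definition surjective_map (X Y : Type) (f : X -> Y) := forall y, exists x, f x = y.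

Definition fin_gen (M : lmodType A) :=
  exists n (m : 'I_n -> M),
    forall x, exists c : 'I_n -> A, x = \sum_i c i *: m i.

Definition fin_presented (M : lmodType A) :=
  exists m n (rho : {linear 'rV[A]_m -> 'rV[A]_n}) (pi : {linear 'rV[A]_n -> M}),
    surjective_map pi /\ forall x, pi x = 0 <-> exists y, rho y = x.

Definition projective (P : lmodType A) :=
  forall (U V : lmodType A) (g : {linear U -> V}) (h : {linear P -> V}),
    surjective_map g -> exists h' : {linear P -> U}, forall x, g (h' x) = h x.

Definition projective_resolution (M : lmodType A) (L : nat -> lmodType A)
    (d : forall n, {linear L n.+1 -> L n}) (eps : {linear L 0 -> M}) :=
  [/\ forall n, projective (L n),
      surjective_map eps,
      forall x, eps x = 0 <-> exists y, d 0 y = x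
    & forall n x, d n x = 0 <-> exists y, d n.+1 y = x].

End ModuleNotions.

Record ideal (A : pzRingType) := Ideal {
  ideal_pred :> zmodClosed A;
  idealMl : forall a x, x \in ideal_pred -> a * x \in ideal_pred;
  idealMr : forall a x, x \in ideal_pred -> x * a \in ideal_pred
}.

Definition generated_ideal (A : pzRingType) (S : set A) : set A :=
  fun x => forall J : ideal A, (forall y, S y -> y \in (J : zmodClosed A)) ->
                               x \in (J : zmodClosed A).

(* The ring quotients of the library are restricted to commutative rings. *)
Section QuotientRing.
Variables (A : pzRingType) (I : ideal A).

Definition quotring : Type := Quotient.quot (I : zmodClosed A).
HB.instance Definition _ := GRing.Zmodule.on quotring.

Definition qpi (x : A) : quotring := \pi_(Quotient.quot (I : zmodClosed A)) x.
Definition qrepr (x : quotring) : A := repr (x : Quotient.quot (I : zmodClosed A)).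

Lemma qreprK : cancel qrepr qpi. Proof. by move=> x; rewrite /qpi reprK. Qed.

Lemma qpiP x y : reflect (qpi x = qpi y) (x - y \in (I : zmodClosed A)).
Proof. by rewrite Quotient.idealrBE; apply: (iffP eqP). Qed.

Lemma qpiD : {morph qpi : x y / x + y}.
Proof. exact: (raddfD (\pi_(Quotient.quot (I : zmodClosed A)))). Qed.

Definition qone : quotring := qpi 1.
Definition qmul (x y : quotring) : quotring := qpi (qrepr x * qrepr y).

Lemma qpiM x y : qmul (qpi x) (qpi y) = qpi (x * y).
Proof.
apply/qpiP; rewrite -[_ - _](subrKA (qrepr (qpi x) * y)).
rewrite -mulrBr -mulrBl rpredD //.
  by apply: idealMl; apply/qpiP; rewrite qreprK.
by apply: idealMr; apply/qpiP; rewrite qreprK.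
Qed.

Lemma qmulA : associative qmul.
Proof.
by move=> x y z; rewrite -[x]qreprK -[y]qreprK -[z]qreprK !qpiM mulrA.
Qed.

Lemma qmul1r : left_id qone qmul.
Proof. by move=> x; rewrite -[x]qreprK qpiM mul1r. Qed.

Lemma qmulr1 : right_id qone qmul.
Proof. by move=> x; rewrite -[x]qreprK qpiM mulr1. Qed.

Lemma qmulDl : left_distributive qmul +%R.
Proof.
move=> x y z; rewrite -[x]qreprK -[y]qreprK -[z]qreprK.
by rewrite -qpiD !qpiM mulrDl qpiD.
Qed.

Lemma qmulDr : right_distributive qmul +%R.
Proof.
move=> x y z; rewrite -[x]qreprK -[y]qreprK -[z]qreprK.
by rewrite -qpiD !qpiM mulrDr qpiD.
Qed.

HB.instance Definition _ :=
  GRing.Zmodule_isPzRing.Build quotring qmulA qmul1r qmulr1 qmulDl qmulDr.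

Definition restr (M : lmodType quotring^c) : Type := M.

Section Restriction.
Variable M : lmodType quotring^c.
HB.instance Definition _ := GRing.Zmodule.on (restr M).

Definition restr_scale (r : A^c) (x : restr M) : restr M :=
  (x : M) ** qpi r.

Lemma restr_scaleA a b x :
  restr_scale a (restr_scale b x) = restr_scale (a * b) x.
Proof.
rewrite /restr_scale /ract scalerA; congr (_ *: _).
exact: (qpiM (b : A) (a : A)).
Qed.

Lemma restr_scale1 : left_id 1 restr_scale.
Proof. by move=> x; rewrite /restr_scale /ract [X in X *: _](_ : _ = 1) ?scale1r. Qed.

Lemma restr_scaleDr : right_distributive restr_scale +%R.
Proof. by move=> a x y; rewrite /restr_scale /ract scalerDr. Qed.

Lemma restr_scaleDl x : {morph restr_scale^~ x : a b / a + b}.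
Proof. by move=> a b; rewrite /restr_scale /ract qpiD scalerDl. Qed.

HB.instance Definition _ := GRing.Zmodule_isLmodule.Build A^c (restr M)
  restr_scaleA restr_scale1 restr_scaleDr restr_scaleDl.
End Restriction.

End QuotientRing.

Section DirectSum.
Variables (A : pzRingType) (N : lmodType A^c) (T : choiceType).

(* Finitely supported families of elements of N indexed by T. *)
Definition dsum : Type := {malg N[T]}.
HB.instance Definition _ := GRing.Zmodule.on dsum.

Definition dcoord (w : dsum) (i : T) : N := (w : {malg N[T]})@_i.

Lemma dsumP (w1 w2 : dsum) : (forall i, dcoord w1 i = dcoord w2 i) -> w1 = w2.
Proof. by move=> w12; apply/malgP. Qed.

Lemma dcoordD w1 w2 i : dcoord (w1 + w2) i = dcoord w1 i + dcoord w2 i.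
Proof. exact: mcoeffD. Qed.

Definition dscale (r : A^c) (w : dsum) : dsum :=
  [malg i in msupp (w : {malg N[T]}) => dcoord w i ** r].

Lemma dscaleE r w i : dcoord (dscale r w) i = dcoord w i ** r.
Proof.
by rewrite [LHS]mcoeffE /dcoord; case: msuppP => //; rewrite /ract scaler0.
Qed.

Lemma dscaleA a b w : dscale a (dscale b w) = dscale (a * b) w.
Proof. by apply: dsumP => i; rewrite !dscaleE /ract scalerA. Qed.

Lemma dscale1 : left_id 1 dscale.
Proof. by move=> w; apply: dsumP => i; rewrite dscaleE /ract scale1r. Qed.

Lemma dscaleDr : right_distributive dscale +%R.
Proof.
by move=> a v w; apply: dsumP => i; rewrite !(dscaleE, dcoordD) /ract scalerDr.
Qed.

Lemma dscaleDl w : {morph dscale^~ w : a b / a + b}.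
Proof.
by move=> a b; apply: dsumP => i; rewrite !(dscaleE, dcoordD) /ract scalerDl.
Qed.

HB.instance Definition _ := GRing.Zmodule_isLmodule.Build A^c dsum
  dscaleA dscale1 dscaleDr dscaleDl.

Lemma dcoordZ (r : A^c) w i : dcoord (r *: w) i = r *: dcoord w i.
Proof. exact: dscaleE. Qed.

End DirectSum.

(* The external direct sum of the cyclic submodules f i A of N. *)
Section Coproduct.
Variables (A : pzRingType) (N : lmodType A^c) (T : choiceType) (f : T -> N).

Definition coprod_pred : {pred dsum N T} :=
  fun w => `[< forall i, exists r, dcoord w i = f i ** r >].

Lemma coprod_closed : subsemimod_closed coprod_pred.
Proof.
split; first split.
- by apply/asboolP => i; exists 0; rewrite /ract scale0r [LHS]mcoeff0.
- move=> v w /asboolP vP /asboolP wP; apply/asboolP => i.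
  have [[r rP] [s sP]] := (vP i, wP i).
  by exists (r + s); rewrite dcoordD rP sP /ract scalerDl.
- move=> a w /asboolP wP; apply/asboolP => i; have [r rP] := wP i.
  by exists (r * a); rewrite dcoordZ rP /ract scalerA.
Qed.

HB.instance Definition _ :=
  GRing.isSubmodClosed.Build A^c (dsum N T) coprod_pred coprod_closed.

Record coprod := Coprod {cval : dsum N T; _ : cval \in coprod_pred}.
HB.instance Definition _ := [isSub for cval].
HB.instance Definition _ := [Choice of coprod by <:].
HB.instance Definition _ := [SubChoice_isSubLmodule of coprod by <:].

Definition ccomp (w : coprod) (i : T) : N := dcoord (cval w) i.

Lemma coprodP (v w : coprod) : (forall i, ccomp v i = ccomp w i) -> v = w.
Proof. by move=> vw; apply/val_inj/dsumP. Qed.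

Lemma ccompP (w : coprod) i : exists r, ccomp w i = f i ** r.
Proof. by case: w => w wP; exact: (elimT (asboolP _) wP i). Qed.

Lemma ccompD v w i : ccomp (v + w) i = ccomp v i + ccomp w i.
Proof. exact: dcoordD. Qed.

Lemma ccompB v w i : ccomp (v - w) i = ccomp v i - ccomp w i.
Proof. exact: mcoeffB. Qed.

Lemma ccompZ (r : A^c) w i : ccomp (r *: w) i = r *: ccomp w i.
Proof. exact: dcoordZ. Qed.

Lemma cinj_subproof i r : (<< f i ** r *g i >> : dsum N T) \in coprod_pred.
Proof.
apply/asboolP => j; rewrite [dcoord _ _]mcoeffU.
case: eqVneq => [<-|_]; first by exists r.
by exists 0; rewrite /ract scale0r.
Qed.

(* f i ** r placed in coordinate i *)
Definition cinj i (r : A) : coprod := Coprod (cinj_subproof i r).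

Definition csum (w : coprod) : N :=
  \sum_(i <- msupp (cval w : {malg N[T]})) ccomp w i.

Lemma csumw (d : {fset T}) w :
  (msupp (cval w : {malg N[T]}) `<=` d)%fset -> csum w = \sum_(i <- d) ccomp w i.
Proof.
move=> wd; rewrite /csum (big_fset_incl _ wd) // => i _.
by move/mcoeff_outdom.
Qed.

Lemma csum_linear : linear csum.
Proof.
move=> a v w.
pose u := a *: v + w; pose d := (msupp (cval u : {malg N[T]}) `|`
  (msupp (cval v : {malg N[T]}) `|` msupp (cval w : {malg N[T]})))%fset.
have dP x : cval x \in [:: cval u; cval v; cval w] ->
    (msupp (cval x : {malg N[T]}) `<=` d)%fset.
  rewrite !inE => /or3P[] /eqP ->; rewrite /d ?fsubsetUl //.
    by rewrite fsetUCA fsubsetUl.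
  by rewrite fsetUA fsubsetUr.
rewrite -/u !(csumw (d := d)) ?dP ?inE ?eqxx ?orbT //.
rewrite scaler_sumr -big_split /=; apply: eq_bigr => i _.
by rewrite ccompD ccompZ.
Qed.

HB.instance Definition _ :=
  GRing.isLinear.Build A^c coprod N _ csum csum_linear.

Variable I : ideal A.

Definition coprodI_pred : {pred coprod} :=
  fun w => `[< forall i, exists2 r, r \in (I : zmodClosed A) & ccomp w i = f i ** r >].

Lemma coprodI_closed : zmod_closed coprodI_pred.
Proof.
split; first by apply/asboolP => i; exists 0; rewrite ?rpred0 // /ract scale0r [LHS]mcoeff0.
move=> v w /asboolP vP /asboolP wP; apply/asboolP => i.
have [[r rI rP] [s sI sP]] := (vP i, wP i).
by exists (r - s); [exact: rpredB | rewrite ccompB rP sP /ract scalerBl].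
Qed.

HB.instance Definition _ := GRing.isZmodClosed.Build coprod coprodI_pred coprodI_closed.

(* The A/I-module (coprod f) / (coprod of the f i I). *)
Definition coprod_mod : Type := Quotient.quot coprodI_pred.
HB.instance Definition _ := GRing.Zmodule.on coprod_mod.

Definition cpi (x : coprod) : coprod_mod := \pi_(Quotient.quot coprodI_pred) x.
Definition crepr (x : coprod_mod) : coprod := repr (x : Quotient.quot coprodI_pred).

Lemma creprK : cancel crepr cpi. Proof. by move=> x; rewrite /cpi reprK. Qed.

Lemma cpiP x y : reflect (cpi x = cpi y) (x - y \in coprodI_pred).
Proof. by rewrite Quotient.idealrBE; apply: (iffP eqP). Qed.

Lemma cpiD : {morph cpi : x y / x + y}.
Proof. exact: (raddfD (\pi_(Quotient.quot coprodI_pred))). Qed.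

Lemma coprodI_ract w r : w \in coprodI_pred -> w ** r \in coprodI_pred.
Proof.
move=> /asboolP wP; apply/asboolP => i; have [s sI sP] := wP i.
exists (s * r); first exact: idealMr.
by rewrite /ract ccompZ sP /ract scalerA.
Qed.

Lemma coprod_ractI w r : r \in (I : zmodClosed A) -> w ** r \in coprodI_pred.
Proof.
move=> rI; apply/asboolP => i; have [s sP] := ccompP w i.
exists (s * r); first exact: idealMl.
by rewrite /ract ccompZ sP /ract scalerA.
Qed.

Definition cscale (r : (quotring I)^c) (x : coprod_mod) : coprod_mod :=
  cpi (crepr x ** qrepr r).

Lemma cscaleE (r : A) x : cscale (qpi I r) (cpi x) = cpi (x ** r).
Proof.
apply/cpiP; rewrite -[_ - _](subrKA (crepr (cpi x) ** r)) /ract.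
rewrite -[X in X + _](scalerBl (qrepr (qpi I r) : A^c)).
rewrite -[X in _ + X](scalerBr (r : A^c)) rpredD //.
  by apply: (@coprod_ractI _ (_ - r)); apply/qpiP; rewrite qreprK.
by apply: (@coprodI_ract _ r); apply/cpiP; rewrite creprK.
Qed.

Lemma cscaleA a b x : cscale a (cscale b x) = cscale (a * b) x.
Proof.
have -> : a * b = qpi I (qrepr b * qrepr a) :> (quotring I)^c.
  by rewrite -qpiM !qreprK.
rewrite -[x]creprK -[a in LHS](@qreprK A I) -[b in LHS](@qreprK A I) !cscaleE.
by rewrite /ract scalerA.
Qed.

Lemma cscale1 : left_id 1 cscale.
Proof.
by move=> x; rewrite -[x]creprK [1](_ : _ = qpi I 1) // cscaleE /ract scale1r.
Qed.

Lemma cscaleDr : right_distributive cscale +%R.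
Proof.
move=> a x y; rewrite -[x]creprK -[y]creprK -[a](@qreprK A I).
by rewrite -cpiD !cscaleE /ract scalerDr cpiD.
Qed.

Lemma cscaleDl x : {morph cscale^~ x : a b / a + b}.
Proof.
move=> a b; rewrite -[x]creprK -[a](@qreprK A I) -[b](@qreprK A I).
by rewrite -[_ + _](qpiD I) !cscaleE /ract scalerDl cpiD.
Qed.

HB.instance Definition _ := GRing.Zmodule_isLmodule.Build (quotring I)^c coprod_mod
  cscaleA cscale1 cscaleDr cscaleDl.

Lemma cpiZ (r : A) x : cpi (x ** r) = cpi x ** qpi I r.
Proof. by rewrite -cscaleE. Qed.

End Coproduct.

Arguments coprod_pred {A N T} f.
Arguments coprodI_pred {A N T} f I.
Arguments coprod_mod {A N T} f I.

(* The maps of the resolution: for g j in the coproduct of the f i A, the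
   inclusion of the internal sum of the g j A induces a map modulo I, which
   sends the class of the j-th generator to the family of the classes of the
   components of g j. *)
Section InducedMaps.
Variables (A : pzRingType) (I : ideal A) (N : lmodType A^c).
Variables (T : choiceType) (f : T -> N).

Section Differential.
Variables (T' : choiceType) (g : T' -> coprod f).

Definition cdiff (x : coprod_mod g I) : coprod_mod f I := cpi I (csum (crepr x)).

Lemma csumI w : w \in coprodI_pred g I -> csum w \in coprodI_pred f I.
Proof.
move=> /asboolP wP; apply: rpred_sum => i _.
by have [r rI ->] := wP i; apply: coprod_ractI.
Qed.

Lemma cdiffE w : cdiff (cpi I w) = cpi I (csum w).
Proof. by apply/cpiP; rewrite -raddfB; apply/csumI/cpiP; rewrite creprK. Qed.

Lemma cdiff_linear : linear cdiff.
Proof.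
move=> a x y; rewrite -[x]creprK -[y]creprK -[a](@qreprK A I).
rewrite -[_ *: cpi I _](cpiZ I (qrepr a)) -cpiD !cdiffE raddfD cpiD.
by congr (_ + _); rewrite -[RHS](cpiZ I (qrepr a)); congr cpi; apply: linearZ.
Qed.

HB.instance Definition _ := GRing.isLinear.Build (quotring I)^c
  (coprod_mod g I) (coprod_mod f I) _ cdiff cdiff_linear.
End Differential.

Section Augmentation.
Variables (M : lmodType (quotring I)^c) (pi : {linear coprod f -> restr M}).

Definition caug (x : coprod_mod f I) : M := pi (crepr x).

Lemma pi_coprodI w : w \in coprodI_pred f I -> pi w = 0.
Proof.
move=> /asboolP wP.
have -> : w = \sum_(i <- msupp (cval w : {malg N[T]})) cinj f i (sval (cid2 (wP i))).
  apply: coprodP => j; rewrite /ccomp.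
  have -> : dcoord (cval (\sum_(i <- msupp (cval w : {malg N[T]}))
      cinj f i (sval (cid2 (wP i))))) j =
    \sum_(i <- msupp (cval w : {malg N[T]}))
      (<< ccomp w i *g i >> : {malg N[T]})@_j.
    rewrite /dcoord -[cval _]/(val _) !raddf_sum; apply: eq_bigr => i _.
    by case: cid2 => r rI /= <-.
  rewrite -raddf_sum; congr (_ @_ j); exact: monalgE.
rewrite raddf_sum big1 // => i _; case: cid2 => r rI _ /=.
have -> : cinj f i r = cinj f i 1 ** r.
  apply: coprodP => j; rewrite ccompZ /ccomp /dcoord /= !mcoeffU.
  by case: eqP => _; rewrite ?scaler0 // /ract scale1r.
rewrite /ract linearZ /= -[LHS]/(_ ** qpi I r).
have -> : qpi I r = 0.
  transitivity (qpi I 0); first by apply/qpiP; rewrite subr0.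
  exact: (raddf0 (\pi_(Quotient.quot (I : zmodClosed A)))).
exact: (scale0r (_ : M)).
Qed.

Lemma caugE w : caug (cpi I w) = pi w.
Proof.
apply/eqP; rewrite -subr_eq0 -[_ - _](raddfB pi); apply/eqP/pi_coprodI/cpiP.
by rewrite creprK.
Qed.

Lemma caug_linear : linear caug.
Proof.
move=> a x y; rewrite -[x]creprK -[y]creprK -[a](@qreprK A I).
rewrite -[_ *: cpi I _](cpiZ I (qrepr a)) -cpiD !caugE raddfD.
by congr (_ + _); apply: (linearZ_LR pi (qrepr a : A^c)).
Qed.

HB.instance Definition _ := GRing.isLinear.Build (quotring I)^c
  (coprod_mod f I) M _ caug caug_linear.
End Augmentation.

End InducedMaps.

Record quiver := Quiver {
  vertex : finType;
  arrow : finType;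
  source : arrow -> vertex;
  target : arrow -> vertex
}.

Section Paths.
Variable Q : quiver.

Fixpoint walk (u : vertex Q) (s : seq (arrow Q)) : bool :=
  if s is a :: s' then (source a == u) && walk (target a) s' else true.

(* A path is its origin together with the sequence of its arrows, in the order
   in which they are followed. *)
Record qpath := QPath {
  path_val : vertex Q * seq (arrow Q);
  _ : walk path_val.1 path_val.2
}.
HB.instance Definition _ := [isSub for path_val].
HB.instance Definition _ := [Countable of qpath by <:].

Definition origin (p : qpath) := (path_val p).1.
Definition arrows (p : qpath) := (path_val p).2.
Definition terminus (p : qpath) := last (origin p) (map (@target Q) (arrows p)).
Definition plength (p : qpath) := size (arrows p).

Definition vpath (v : vertex Q) : qpath := @QPath (v, [::]) isT.

(* [pcat p q = None] stands for p q = 0. *)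
Definition pcat (p q : qpath) : option qpath :=
  if terminus p == origin q then insub (origin p, arrows p ++ arrows q) else None.

Definition pdiv (p q : qpath) :=
  exists r s u, pcat r p = Some u /\ pcat u s = Some q.
Definition pldiv (p q : qpath) := exists s, pcat p s = Some q.
Definition prdiv (p q : qpath) := exists r, pcat r p = Some q.

Lemma walk_cat u s t :
  walk u (s ++ t) = walk u s && walk (last u (map (@target Q) s)) t.
Proof. by elim: s u => [|a s IHs] u //=; rewrite IHs andbA. Qed.

Lemma path_ext p q : origin p = origin q -> arrows p = arrows q -> p = q.
Proof.
case: p q => [[u s] p] [[v t] q]; rewrite /origin /arrows /= => eq1 eq2.
by apply: val_inj; rewrite /= eq1 eq2.
Qed.

Variant pcat_spec p q : option qpath -> Prop :=
| PcatSome r of terminus p = origin q & origin r = origin p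
    & arrows r = arrows p ++ arrows q & terminus r = terminus q :
    pcat_spec p q (Some r)
| PcatNone of terminus p <> origin q : pcat_spec p q None.

Lemma pcatP p q : pcat_spec p q (pcat p q).
Proof.
rewrite /pcat; case: eqP => [pq|npq]; last exact: PcatNone.
case: insubP => [r _ rE|]; last first.
  rewrite /= walk_cat -[last _ _]/(terminus p) pq.
  by move: (valP p) (valP q); rewrite /= /origin /arrows => -> ->.
have [ro ra] : origin r = origin p /\ arrows r = arrows p ++ arrows q.
  by rewrite /origin /arrows -[path_val r]/(val r) rE.
apply: PcatSome => //; rewrite /terminus ro ra map_cat last_cat.
by rewrite -/(terminus p) pq.
Qed.

Lemma pcatA p q r :
  obind (fun u => pcat u r) (pcat p q) = obind (pcat p) (pcat q r).
Proof.
case: (pcatP p q) => [u pq uo ua ut|npq]; case: (pcatP q r) => [v qr vo va vt|nqr] //=.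
- case: (pcatP u r) => [x _ xo xa _|]; last by rewrite ut.
  case: (pcatP p v) => [y _ yo ya _|]; last by rewrite vo.
  by congr Some; apply: path_ext; rewrite ?xo ?yo // xa ya ua va catA.
- by case: (pcatP u r) => // x; rewrite ut.
- by case: (pcatP p v) => // x; rewrite vo.
Qed.

Lemma pcat1p v p : pcat (vpath v) p = if v == origin p then Some p else None.
Proof.
case: pcatP => [r vp ro ra _|vp]; rewrite -[v in RHS]/(terminus (vpath v)).
  by rewrite vp eqxx; congr Some; apply: path_ext; rewrite // ro -vp.
by case: eqP.
Qed.

Lemma pcatp1 v p : pcat p (vpath v) = if v == terminus p then Some p else None.
Proof.
case: pcatP => [r pv ro ra _|pv].
  by rewrite pv eqxx; congr Some; apply: path_ext; rewrite // ra cats0.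
by case: eqP => // vp; case: pv; rewrite vp.
Qed.

(* le is the reflexive order underlying an admissible order. *)
Record admissible_order (le : rel qpath) : Prop := {
  admissible_wo : well_order le;
  admissible_r : forall p q r pr qr, pcat p r = Some pr -> pcat q r = Some qr ->
    q != p -> le q p -> qr != pr /\ le qr pr;
  admissible_l : forall p q r rp rq, pcat r p = Some rp -> pcat r q = Some rq ->
    q != p -> le q p -> rq != rp /\ le rq rp;
  admissible_div : forall p q r, pcat q r = Some p -> le q p /\ le r p
}.

End Paths.

Section PathAlgebra.
Variables (k : fieldType) (Q : quiver).

Definition palg : Type := {malg k[qpath Q]}.
HB.instance Definition _ := GRing.Lmodule.on palg.

Implicit Types x y z : {malg k[qpath Q]}.

Definition pmon (c : k) (p q : qpath Q) : {malg k[qpath Q]} :=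
  if pcat p q is Some r then << c *g r >> else 0.

Definition pmul x y : {malg k[qpath Q]} :=
  \sum_(p <- msupp x) \sum_(q <- msupp y) pmon (x@_p * y@_q) p q.

Definition pone : {malg k[qpath Q]} := \sum_(v : vertex Q) << vpath v >>.

Lemma pmon0 p q : pmon 0 p q = 0.
Proof. by rewrite /pmon; case: pcat => // r; rewrite monalgU0. Qed.

Lemma pmonD c d p q : pmon (c + d) p q = pmon c p q + pmon d p q.
Proof. by rewrite /pmon; case: pcat => [r|]; rewrite ?monalgUD ?addr0. Qed.

Lemma pmulw (d1 d2 : {fset qpath Q}) x y :
  (msupp x `<=` d1)%fset -> (msupp y `<=` d2)%fset ->
  pmul x y = \sum_(p <- d1) \sum_(q <- d2) pmon (x@_p * y@_q) p q.
Proof.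
move=> xd yd; rewrite /pmul (big_fset_incl _ xd) /=; last first.
  by move=> p _ /mcoeff_outdom ->; rewrite big1 // => q _; rewrite mul0r pmon0.
apply: eq_bigr => p _; apply: big_fset_incl => // q _ /mcoeff_outdom ->.
by rewrite mulr0 pmon0.
Qed.

Lemma pmulDl : left_distributive pmul +%R.
Proof.
move=> x y z; pose d := (msupp (x + y)%R `|` (msupp x `|` msupp y))%fset.
have dx : (msupp x `<=` d)%fset by rewrite /d fsetUCA fsubsetUl.
have dy : (msupp y `<=` d)%fset by rewrite /d fsetUA fsubsetUr.
have dxy : (msupp (x + y)%R `<=` d)%fset by rewrite fsubsetUl.
rewrite (pmulw dx (fsubset_refl _)) (pmulw dy (fsubset_refl _)).
rewrite (pmulw dxy (fsubset_refl _)) -big_split; apply: eq_bigr => p _.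
by rewrite -big_split; apply: eq_bigr => q _; rewrite mcoeffD mulrDl pmonD.
Qed.

Lemma pmulDr : right_distributive pmul +%R.
Proof.
move=> z x y; pose d := (msupp (x + y)%R `|` (msupp x `|` msupp y))%fset.
have dx : (msupp x `<=` d)%fset by rewrite /d fsetUCA fsubsetUl.
have dy : (msupp y `<=` d)%fset by rewrite /d fsetUA fsubsetUr.
have dxy : (msupp (x + y)%R `<=` d)%fset by rewrite fsubsetUl.
rewrite (pmulw (fsubset_refl _) dx) (pmulw (fsubset_refl _) dy).
rewrite (pmulw (fsubset_refl _) dxy) -big_split; apply: eq_bigr => p _.
by rewrite -big_split; apply: eq_bigr => q _; rewrite mcoeffD mulrDr pmonD.
Qed.

Lemma pmul0l x : pmul 0 x = 0.
Proof. by rewrite /pmul msupp0 big_seq_fset0. Qed.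

Lemma pmul0r x : pmul x 0 = 0.
Proof. by rewrite /pmul big1 // => p _; rewrite msupp0 big_seq_fset0. Qed.

Lemma pmul_suml J (s : seq J) F x :
  pmul (\sum_(j <- s) F j) x = \sum_(j <- s) pmul (F j) x.
Proof. by apply: (big_morph (pmul^~ x)) => [y z|]; rewrite ?pmulDl ?pmul0l. Qed.

Lemma pmul_sumr J (s : seq J) F x :
  pmul x (\sum_(j <- s) F j) = \sum_(j <- s) pmul x (F j).
Proof. by apply: (big_morph (pmul x)) => [y z|]; rewrite ?pmulDr ?pmul0r. Qed.

Lemma pmulU c d p q : pmul << c *g p >> << d *g q >> = pmon (c * d) p q.
Proof. by rewrite (pmulw msuppU_le msuppU_le) !big_seq_fset1 !mcoeffUU. Qed.

Lemma pmul_monA c d e p q r :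
  pmul << c *g p >> (pmul << d *g q >> << e *g r >>) =
  pmul (pmul << c *g p >> << d *g q >>) << e *g r >>.
Proof.
apply: etrans (congr1 (pmul _) (pmulU _ _ _ _)) _.
apply: etrans (congr1 (pmul^~ _) (esym (pmulU _ _ _ _))).
rewrite /pmon; have := pcatA p q r.
case: (pcat p q) => [u|]; case: (pcat q r) => [v|] /= uv.
- apply: etrans (pmulU _ _ _ _) _; apply: etrans (esym (pmulU _ _ _ _)).
  by rewrite /pmon uv mulrA.
- apply: etrans (pmul0r _) _; apply: etrans (esym (pmulU _ _ _ _)).
  by rewrite /pmon uv.
- apply: etrans (esym (pmul0l _)); apply: etrans (pmulU _ _ _ _) _.
  by rewrite /pmon -uv.
- exact: etrans (pmul0r _) (esym (pmul0l _)).
Qed.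

Lemma pmulA : associative pmul.
Proof.
move: pmul (@pmul_suml) (@pmul_sumr) pmul_monA => m m_suml m_sumr m_monA x y z.
rewrite [x]monalgE [y]monalgE [z]monalgE.
rewrite [LHS]m_suml [X in _ = m X _]m_suml [RHS]m_suml; apply: eq_bigr => p _.
rewrite [X in m _ X = _]m_suml [LHS]m_sumr [X in _ = m X _]m_sumr [RHS]m_suml.
apply: eq_bigr => q _; rewrite [X in m _ X = _]m_sumr [LHS]m_sumr [RHS]m_sumr.
by apply: eq_bigr => r _; apply: m_monA.
Qed.

Lemma pmul1 : left_id pone pmul.
Proof.
move=> x; rewrite [in RHS](monalgE x) [in LHS](monalgE x) pmul_sumr.
apply: eq_bigr => p _; rewrite /pone pmul_suml (bigD1 (origin p)) //= big1.
  by rewrite addr0 pmulU /pmon pcat1p eqxx mul1r.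
by move=> v vp; rewrite pmulU /pmon pcat1p (negPf vp).
Qed.

Lemma pmulr1 : right_id pone pmul.
Proof.
move=> x; rewrite [in RHS](monalgE x) [in LHS](monalgE x) pmul_suml.
apply: eq_bigr => p _; rewrite /pone pmul_sumr (bigD1 (terminus p)) //= big1.
  by rewrite addr0 pmulU /pmon pcatp1 eqxx mulr1.
by move=> v vp; rewrite pmulU /pmon pcatp1 (negPf vp).
Qed.

HB.instance Definition _ :=
  GRing.Zmodule_isPzRing.Build palg pmulA pmul1 pmulr1 pmulDl pmulDr.

Definition pcoef (x : palg) (p : qpath Q) : k := (x : {malg k[qpath Q]})@_p.

End PathAlgebra.

(* The path p as an element of the path algebra. *)
HB.lock Definition pbase (k : fieldType) (Q : quiver) (p : qpath Q) : palg k Q :=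
  << p >>.

Section Uniform.
Variables (k : fieldType) (Q : quiver).
Local Notation R := (palg k Q).

Definition uniform (x : R) :=
  x != 0 /\ exists u v, x = pbase k (vpath u) * x * pbase k (vpath v).

Definition right_uniform (N : lmodType R^c) (x : N) :=
  x != 0 /\ exists v, x = x ** pbase k (vpath v).

End Uniform.

Section Groebner.
Variables (k : fieldType) (Q : quiver) (le : rel (qpath Q)).
Local Notation R := (palg k Q).
Implicit Types (x g : R) (p q r s t : qpath Q) (G X : set R) (I : ideal R).

Definition is_tip x p := pcoef x p != 0 /\ forall q, pcoef x q != 0 -> le q p.

Definition tips X : set R := fun y => exists x p, [/\ X x, is_tip x p & y = pbase k p].

Definition groebner_basis I G :=
  (forall g, G g -> g \in (I : zmodClosed R)) /\
  generated_ideal (tips G) =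
  generated_ideal (tips (fun x => x \in (I : zmodClosed R))).

Definition tip_reduced X :=
  (forall x, X x -> x != 0) /\
  forall x y p q, X x -> X y -> is_tip x p -> is_tip y q -> pdiv p q -> x = y.

Section Overlaps.
Variable G : set R.

(* g is the end relation of q and q = q' tip(g). *)
Definition end_relation q g q' :=
  G g /\ exists2 t, is_tip g t & pcat q' t = Some q.

Definition Xset p q :=
  [/\ pldiv p q,
      exists g t, [/\ G g, is_tip g t & prdiv t q]
    & forall g t r s u, G g -> is_tip g t ->
        pcat r t = Some u -> pcat u s = Some q -> plength s = 0%N].

Definition Oset p q :=
  Xset p q /\ exists g q', end_relation q g q' /\ (plength q' < plength p)%N.

Definition Nset p q := Xset p q /\ ~ Oset p q.
End Overlaps.

End Groebner.

Section Tips.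
Variables (k : fieldType) (Q : quiver).
Local Notation R := (palg k Q).
Variables (N : lmodType R^c) (T : choiceType) (f : T -> N).

(* w i = f i ** r with r in v_i R, where f i = f i ** v_i; such an r is unique. *)
Definition is_ccoord (w : coprod f) i (r : R) :=
  ccomp w i = f i ** r /\
  exists2 v, f i = f i ** pbase k (vpath v) & r = pbase k (vpath v) * r.

(* The coefficient in w of the basis element f b.1 ** b.2. *)
Definition ccoef (w : coprod f) (b : T * qpath Q) : k :=
  pcoef (xget 0 [set r | is_ccoord w b.1 r]%classic) b.2.

Variable ord : T * qpath Q -> T * qpath Q -> Prop.

Definition is_ctip (w : coprod f) b :=
  ccoef w b != 0 /\ forall b', ccoef w b' != 0 -> ord b' b.

Definition right_tip_reduced (X : set (coprod f)) :=
  forall x y b b', X x -> X y -> is_ctip x b -> is_ctip y b' ->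
    b.1 = b'.1 -> pldiv b.2 b'.2 -> x = y.
End Tips.

Section Resolution.
Variables (k : fieldType) (Q : quiver) (le : rel (qpath Q)).
Local Notation R := (palg k Q).
Variable I : ideal R.

Definition base_ord (T : eqType) (leT : rel T) (b b' : T * qpath Q) : Prop :=
  if b.2 == b'.2 then leT b.1 b'.1 else le b.2 b'.2.

Record admissible_presentation (M : lmodType (quotring I)^c) := AdmPres {
  pT0 : choiceType;
  ple0 : rel pT0;
  ple0_wo : well_order ple0;
  pf0 : pT0 -> (R^c)^o;
  pf0_uniform : forall i, right_uniform (pf0 i);
  pT1 : choiceType;
  pU1 : choiceType;
  pf1 : pT1 -> coprod pf0;
  pf1' : pU1 -> coprod pf0;
  pf1_uniform : forall i, right_uniform (pf1 i);
  pf1'_uniform : forall j, right_uniform (pf1' j);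
  pf1'_I : forall j, pf1' j \in coprodI_pred pf0 I;
  pf1_reduced : right_tip_reduced (base_ord ple0) (range pf1 `|` range pf1')%classic;
  ppi : {linear coprod pf0 -> restr M};
  ppi_surj : surjective_map ppi;
  pH_inj : forall (x : coprod pf1) (y : coprod pf1'),
    csum x + csum y = 0 -> x = 0 /\ y = 0;
  pH_exact : forall z : coprod pf0,
    ppi z = 0 <-> exists (x : coprod pf1) (y : coprod pf1'), z = csum x + csum y
}.

(* The data of level n >= 1: sf is f^{n-1} (indexed by T_{n-1}), sord is the
   order on the basis of the coproduct of the f^{n-1}_i R, and sg, sg' are f^n
   and f^n' (indexed by T_n and U_n). *)
Record stage := Stage {
  sN : lmodType R^c;
  sT : choiceType;
  sf : sT -> sN;
  sord : sT * qpath Q -> sT * qpath Q -> Prop;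
  sT' : choiceType;
  sU' : choiceType;
  sg : sT' -> coprod sf;
  sg' : sU' -> coprod sf
}.

Definition first_stage (M : lmodType (quotring I)^c)
    (P : admissible_presentation M) : stage :=
  Stage (base_ord (@ple0 _ P)) (@pf1 _ P) (@pf1' _ P).

Section NextStage.
Variables (G : set R) (S : stage).

Definition nextT : choiceType :=
  {x : sT' S * qpath Q |
     `[< exists2 b, is_ctip (@sord S) (sg x.1) b & Oset le G b.2 x.2 >]}.

Definition nextU : choiceType :=
  {x : sT' S * qpath Q |
     `[< exists2 b, is_ctip (@sord S) (sg x.1) b & Nset le G b.2 x.2 >]}.

Definition next_ord (b b' : sT' S * qpath Q) : Prop :=
  exists c c', [/\ is_ctip (@sord S) (sg b.1 ** pbase k b.2) c,
                   is_ctip (@sord S) (sg b'.1 ** pbase k b'.2) c'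
                 & sord c c'].

(* y = f^n_i p - sum_l f^n_l r_l, where i = x.1, b is the tip of f^n_i,
   q = x.2 = b.2 p = q' t, t = tip(g), and yl = (f^n_l r_l)_l, yl' = (f^n_l' s_l)_l. *)
Definition next_f_spec (x : sT' S * qpath Q) (y : coprod (@sg S)) :=
  exists b p g q' t (yl : coprod (@sg S)) (yl' : coprod (@sg' S)),
  [/\ is_ctip (@sord S) (sg x.1) b,
      pcat b.2 p = Some x.2,
      [/\ G g, is_tip le g t & pcat q' t = Some x.2],
      sg x.1 ** pbase k p
        - cinj (@sf S) b.1 ((ccoef (sg x.1) b / pcoef g t) *: (pbase k q' * g))
      = csum yl + csum yl'
    & y = cinj (@sg S) x.1 (pbase k p) - yl].

(* y = f^n_i z g, where i = x.1 and q = x.2 = tippath(f^n_i) z tip(g). *)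
Definition next_f'_spec (x : sT' S * qpath Q) (y : coprod (@sg S)) :=
  exists b z g q' t,
  [/\ is_ctip (@sord S) (sg x.1) b,
      [/\ G g, is_tip le g t & pcat q' t = Some x.2],
      pcat b.2 z = Some q'
    & y = cinj (@sg S) x.1 (pbase k z * g)].

Definition next_stage : stage :=
  @Stage (coprod (@sf S)) (sT' S) (@sg S) next_ord nextT nextU
    (fun x => xget 0 [set y | next_f_spec (val x) y]%classic)
    (fun x => xget 0 [set y | next_f'_spec (val x) y]%classic).
End NextStage.

Section Associated.
Variables (G : set R) (M : lmodType (quotring I)^c) (P : admissible_presentation M).

(* Level n + 1 of the construction. *)
Definition stages n : stage := iter n (next_stage G) (first_stage P).

Definition resL n : lmodType (quotring I)^c := coprod_mod (@sf (stages n)) I.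

Definition resd n : {linear resL n.+1 -> resL n} := @cdiff _ I _ _ _ _ (@sg (stages n)).

Definition resaug : {linear resL 0 -> M} := @caug _ I _ _ _ M (@ppi _ P).

End Associated.

End Resolution.

(* Main.v *)
(* Everything rests on one step.  Suppose that the [h_j] in a coproduct of
   modules [f_i R] have tips none of which left divides another.  The tips of
   the [h_j p] are then pairwise distinct, so that a nonzero sum of multiples of
   the [h_j] has the largest of these tips as its tip: the sum of the [h_j R] is
   direct, and a submodule all of whose tips are multiples of tips of the [h_j]
   is spanned by them, by reduction along the well-order.

   Let the family consist of the [f^n_i] and the [f^n_j'], and let [w] be both in
   the sum of the [f^n_i R] and in the coproduct of the [f^(n-1)_i I].  The tip
   of [w] is a multiple [p_i r] of the tip path [p_i] of some [f^n_i], and it is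
   divisible by a tip of [G].  Its shortest prefix divisible by such a tip has
   [p_i] as a prefix, because the coproduct of the [f^(n-1)_i I] is contained in
   the span of the family, whose tips do not left divide each other.  So that
   prefix is in [O(p_i)] or [N(p_i)] and is the tip of some [f^(n+1)] or
   [f^(n+1)'], and reduction gives exactness.

   The starting presentation takes [f^0] to be vertices and [f^1] to have as
   tips the minimal tips of the kernel [K] of the map onto [M].  Being finitely
   generated and the direct sum of the nonzero [f^1_i R], [K] has only finitely
   many [f^1_i].  The tips of [G] are among the tips of the given finite
   Groebner basis, so the paths in [O(p)] have bounded length and every [T_n] is
   finite. *)
From HB Require Import structures.
Require Import Defs.
From mathcomp Require Import all_boot all_order all_algebra.
From mathcomp Require Import finmap.
From mathcomp.multinomials Require Import monalg.
From mathcomp Require Import boolp classical_sets cardinality wochoice.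
Set Implicit Arguments.
Unset Strict Implicit.
Unset Printing Implicit Defensive.
Import GRing.Theory.
Local Open Scope ring_scope.

(** * Orders and paths *)

Section WellOrder.
Variables (T : eqType) (R : rel T).
Hypothesis R_wo : well_order R.

Let R_chain : wo_chain R predT. Proof. exact: withinW R_wo. Qed.

Lemma wo_refl x : R x x.
Proof. exact: (wo_chain_reflexive R_chain). Qed.

Lemma wo_anti x y : R x y -> R y x -> x = y.
Proof.
by move=> xy yx; apply: (wo_chain_antisymmetric R_chain) => //; rewrite xy.
Qed.

Lemma wo_total x y : R x y || R y x.
Proof. exact: (wo_chainW R_chain). Qed.

(** The least element of the set of [x], [y], [z] decides: if it is [y] or [z], antisymmetry
    identifies two neighbours of the chain. *)
Lemma wo_trans y x z : R x y -> R y z -> R x z.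
Proof.
move=> xy yz.
have [|w [[wA wmin] _]] := R_wo (A := mem [:: x; y; z]).
  by exists x; rewrite inE eqxx.
have {}wmin u : u \in [:: x; y; z] -> R w u by move=> uA; apply: wmin.
move: wA; rewrite !inE => /or3P[] /eqP wE.
- by rewrite -wE wmin // !inE eqxx !orbT.
- by rewrite (wo_anti xy) // -wE wmin // inE eqxx.
- by rewrite -(wo_anti yz) // -wE wmin // !inE eqxx orbT.
Qed.

Lemma wo_min (A : set T) : (exists x, A x) ->
  exists2 x, A x & forall y, A y -> R x y.
Proof.
move=> [x Ax]; have [|w [[wA wmin] _]] := R_wo (A := fun z => `[< A z >]).
  by exists x; apply/asboolP.
exists w; first by apply/asboolP; apply: wA.
by move=> y Ay; apply: wmin; apply/asboolP.
Qed.
End WellOrder.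

(** The orders on bases of coproducts are [Prop]-valued and behave as orders only on valid pairs, so
    totality and transitivity are asked on the list alone. *)
Lemma seq_max (B : eqType) (r : B -> B -> Prop) (s : seq B) :
  {in s &, forall x y, r x y \/ r y x} ->
  {in s & &, forall y x z, r x y -> r y z -> r x z} ->
  s <> [::] -> exists2 b, b \in s & {in s, forall b', r b' b}.
Proof.
elim: s => // a s IHs tot trans _.
have raa : r a a by case: (tot _ _ (mem_head a s) (mem_head a s)).
have [->|/IHs IH] := pselect (s = [::]).
  by exists a => [|b]; rewrite ?mem_head // inE => /eqP ->.
have sub x : x \in s -> x \in a :: s by rewrite inE orbC => ->.
have [||b bs bmax] := IH.
- by move=> x y xs ys; apply: tot; apply: sub.
- by move=> x y z xs ys zs; apply: trans; apply: sub.
have [ab|ba] := tot _ _ (mem_head a s) (sub _ bs).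
  exists b; first exact: sub.
  by move=> c; rewrite inE => /predU1P[->//|/bmax].
exists a => [|c]; first exact: mem_head.
rewrite inE => /predU1P[->//|cs].
apply: (trans b) => //; [exact: sub | by rewrite inE cs orbT | exact: mem_head | exact: bmax].
Qed.

Section PathLemmas.
Variable Q : quiver.
Implicit Types p q r s t u w : qpath Q.

Lemma pcat_inv p q u : pcat p q = Some u ->
  [/\ terminus p = origin q, origin u = origin p, arrows u = arrows p ++ arrows q
    & terminus u = terminus q].
Proof. by case: pcatP => // r pq ro ra rt [<-]. Qed.

Lemma pcat_ex p q : terminus p = origin q -> exists u, pcat p q = Some u.
Proof. by case: pcatP => // r; exists r. Qed.

Lemma pcat_plength p q u : pcat p q = Some u -> plength u = (plength p + plength q)%N.
Proof. by case/pcat_inv => _ _ ua _; rewrite /plength ua size_cat. Qed.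

Lemma pcat_injl p q q' u : pcat p q = Some u -> pcat p q' = Some u -> q = q'.
Proof.
move=> /pcat_inv[pq _ ua _] /pcat_inv[pq' _ ua' _]; apply: path_ext; first by rewrite -pq.
by move/eqP: ua'; rewrite ua eqseq_cat // eqxx => /eqP.
Qed.

Lemma pcat_injr p p' q u : pcat p q = Some u -> pcat p' q = Some u -> p = p'.
Proof.
move=> /pcat_inv[_ uo ua _] /pcat_inv[_ uo' ua' _]; apply: path_ext.
  by rewrite -uo uo'.
have: size (arrows p) = size (arrows p').
  by apply/eqP; rewrite -(eqn_add2r (size (arrows q))) -!size_cat -ua ua'.
by move=> psz; move/eqP: ua'; rewrite ua eqseq_cat // => /andP[/eqP].
Qed.

Lemma pcat_assoc p q r pq u : pcat p q = Some pq -> pcat pq r = Some u ->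
  exists2 qr, pcat q r = Some qr & pcat p qr = Some u.
Proof.
move=> pqE uE; have := pcatA p q r; rewrite pqE /= uE.
by case qrE: (pcat q r) => [qr|] //= puE; exists qr.
Qed.

Lemma pcat_assocV p q r qr u : pcat q r = Some qr -> pcat p qr = Some u ->
  exists2 pq, pcat p q = Some pq & pcat pq r = Some u.
Proof.
move=> qrE uE; have := pcatA p q r; rewrite qrE /= uE.
by case pqE: (pcat p q) => [pq|] //= puE; exists pq.
Qed.

Lemma pcat_vpathr p : pcat p (vpath (terminus p)) = Some p.
Proof. by rewrite pcatp1 eqxx. Qed.

Lemma pcat_vpathl p : pcat (vpath (origin p)) p = Some p.
Proof. by rewrite pcat1p eqxx. Qed.

Lemma plength0 p : plength p = 0%N -> p = vpath (origin p).
Proof. by move=> /size0nil pa; apply: path_ext. Qed.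

Lemma pcat_plength0 p s u : pcat p s = Some u -> plength s = 0%N -> u = p.
Proof.
move=> psu /plength0 sE; have [ps _ _ _] := pcat_inv psu.
by move: psu; rewrite sE -ps pcat_vpathr => -[].
Qed.

Lemma pldiv_refl p : pldiv p p.
Proof. by exists (vpath (terminus p)); rewrite pcat_vpathr. Qed.

Lemma pldiv_trans q p r : pldiv p q -> pldiv q r -> pldiv p r.
Proof.
move=> [s psq] [t qtr]; have [st _ pst] := pcat_assoc psq qtr; by exists st.
Qed.

(** Both arrow sequences are initial segments of that of [u], so the shorter begins the longer; the
    cofactor consists of the remaining arrows of [q]. *)
Lemma pldiv_total p q u : pldiv p u -> pldiv q u ->
  (plength p <= plength q)%N -> pldiv p q.
Proof.
move=> [s /pcat_inv[ps po pa _]] [t /pcat_inv[qt qo qa _]] pq.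
have qE : arrows q = arrows p ++ drop (plength p) (arrows q).
  rewrite -[LHS](cat_take_drop (plength p)); congr (_ ++ _).
  have := congr1 (take (plength p)) pa; rewrite qa take_cat take_size_cat //.
  case: ltnP => //; rewrite -/(plength q) => qp.
  have -> : plength p = plength q by apply/eqP; rewrite eqn_leq pq qp.
  by rewrite subnn take0 cats0 => <-; rewrite take_size.
have wq : walk (terminus p) (drop (plength p) (arrows q)).
  have := valP q; rewrite -[(val q).1]/(origin q) -[(val q).2]/(arrows q) qE.
  rewrite walk_cat -qo po => /andP[_ h]; by move: h; rewrite -qE.
exists (QPath (path_val := (terminus p, drop (plength p) (arrows q))) wq).
case: pcatP => //= r _ ro ra _; congr Some; apply: path_ext; first by rewrite ro -po.
by rewrite ra [RHS]qE.
Qed.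

Lemma pldiv_anti p q : pldiv p q -> (plength q <= plength p)%N -> p = q.
Proof.
move=> [s psq] qp; rewrite (pcat_plength0 psq) //.
by move: qp; rewrite (pcat_plength psq) -[X in (_ <= X)%N]addn0 leq_add2l leqn0 => /eqP.
Qed.

(** There are finitely many words of bounded length in the arrows; [insub] discards the pairs of a
    vertex and a word that are not paths. *)
Lemma finite_paths n : exists s : seq (qpath Q), forall p, (plength p <= n)%N -> p \in s.
Proof.
pose words := iter n (fun L => [::] :: [seq a :: l | a <- enum (arrow Q), l <- L]) [:: [::]].
have wordsP l : (size l <= n)%N -> l \in words.
  rewrite /words; elim: (n) l => [|m IHm] [|a l] //= lm.
  rewrite inE; apply/orP; right; apply/allpairsP; exists (a, l).
  by rewrite mem_enum IHm.
exists (pmap insub [seq (v, l) | v <- enum (vertex Q), l <- words]) => p pn.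
rewrite mem_pmap_sub; apply/allpairsP; exists (val p).
by rewrite mem_enum wordsP //; split => //; case: (val p).
Qed.
End PathLemmas.

Section AdmissibleOrder.
Variables (Q : quiver) (le : rel (qpath Q)).
Hypothesis le_adm : admissible_order le.
Implicit Types p q r : qpath Q.

Let le_wo := admissible_wo le_adm.

Lemma adm_r p q r pr qr : pcat p r = Some pr -> pcat q r = Some qr ->
  le q p -> le qr pr.
Proof.
move=> prE qrE qp; have [qpE|qp'] := eqVneq q p; last by case: (admissible_r le_adm prE qrE).
by move: qrE; rewrite qpE prE => -[->]; apply: wo_refl.
Qed.

Lemma adm_l p q r rp rq : pcat r p = Some rp -> pcat r q = Some rq ->
  le q p -> le rq rp.
Proof.
move=> prE qrE qp; have [qpE|qp'] := eqVneq q p; last by case: (admissible_l le_adm prE qrE).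
by move: qrE; rewrite qpE prE => -[->]; apply: wo_refl.
Qed.

(** Totality reverses monotonicity: if instead [p] is below [q], antisymmetry makes [rp] and [rq]
    equal, and [r] cancels. *)
Lemma adm_l_iff p q r rp rq : pcat r p = Some rp -> pcat r q = Some rq ->
  le rq rp <-> le q p.
Proof.
move=> rpE rqE; split; last exact: adm_l rpE rqE.
have /orP[//|pq] := wo_total le_wo q p => rqp.
have rpq := adm_l rqE rpE pq.
have rE := wo_anti le_wo rqp rpq; subst rq.
by rewrite (pcat_injl rpE rqE) (wo_refl le_wo).
Qed.
End AdmissibleOrder.

(** * The path algebra *)

Section PathAlgebraLemmas.
Variables (k : fieldType) (Q : quiver).
Local Notation R := (palg k Q).
Local Notation e v := (pbase k (vpath v)).
Implicit Types (x y z : R) (p q r u : qpath Q) (c : k).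

Lemma palgP x y : (forall p, pcoef x p = pcoef y p) -> x = y.
Proof. by move=> xy; apply/malgP. Qed.

Lemma pcoefD x y p : pcoef (x + y) p = pcoef x p + pcoef y p.
Proof. exact: mcoeffD. Qed.
Lemma pcoefB x y p : pcoef (x - y) p = pcoef x p - pcoef y p.
Proof. exact: mcoeffB. Qed.
Lemma pcoef0 p : pcoef (0 : R) p = 0.
Proof. exact: mcoeff0. Qed.
Lemma pcoefZ c x p : pcoef (c *: x) p = c * pcoef x p.
Proof. exact: mcoeffZ. Qed.
Lemma pcoef_sum (J : Type) (s : seq J) (P : pred J) (F : J -> R) p :
  pcoef (\sum_(j <- s | P j) F j) p = \sum_(j <- s | P j) pcoef (F j) p.
Proof. exact: (big_morph (fun x => pcoef x p) (fun x y => pcoefD x y p) (pcoef0 p)). Qed.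

Lemma pcoef_base p q : pcoef (pbase k p) q = (p == q)%:R.
Proof. by rewrite unlock /pcoef mcoeffU. Qed.

Definition psupp x : seq (qpath Q) := msupp (x : {malg k[qpath Q]}).

Lemma psuppP x p : (p \in psupp x) = (pcoef x p != 0).
Proof. exact/esym/mcoeff_neq0. Qed.

Lemma psupp_uniq x : uniq (psupp x).
Proof. exact: fset_uniq. Qed.

Lemma pbaseM p q :
  pbase k p * pbase k q = if pcat p q is Some r then pbase k r else 0.
Proof.
rewrite unlock; apply: etrans (pmulU _ _ _ _) _.
by rewrite mulr1 /pmon; case: pcat => [r|]; rewrite ?unlock.
Qed.

Lemma palgE x : x = \sum_(p <- psupp x) pcoef x p *: pbase k p.
Proof.
apply: palgP => p; rewrite pcoef_sum.
have [px|px] := boolP (p \in psupp x); last first.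
  rewrite big_seq big1 => [|q qx].
    by apply/eqP; rewrite -[_ == _]negbK -psuppP.
  by rewrite pcoefZ pcoef_base; case: eqP px => [<-|]; rewrite ?qx ?mulr0.
rewrite (bigD1_seq p) ?psupp_uniq //= big1 ?addr0 => [|q qp].
  by rewrite pcoefZ pcoef_base eqxx mulr1.
by rewrite pcoefZ pcoef_base (negPf qp) mulr0.
Qed.

Lemma scale_pbase c p : (c *: pbase k p : R) = << c *g p >>.
Proof.
apply: palgP => u; rewrite pcoefZ pcoef_base /pcoef mcoeffU.
by case: eqP => _; rewrite ?mulr1 ?mulr0.
Qed.

Lemma palg_scaleE c x : c *: x = \sum_(p <- psupp x) (c * pcoef x p) *: pbase k p.
Proof. by rewrite {1}[x]palgE scaler_sumr; apply: eq_bigr => p _; rewrite scalerA. Qed.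

Lemma scale_pbaseM c d p q : (c *: pbase k p) * (d *: pbase k q) =
  (c * d) *: (pbase k p * pbase k q).
Proof.
rewrite !scale_pbase pbaseM; apply: etrans (pmulU _ _ _ _) _.
by rewrite /pmon; case: pcat => [r|]; rewrite ?scale_pbase ?scaler0.
Qed.

Lemma palg_mulE x y : x * y = \sum_(p <- psupp x) \sum_(q <- psupp y)
  (pcoef x p * pcoef y q) *: (pbase k p * pbase k q).
Proof.
rewrite {1}[x]palgE mulr_suml; apply: eq_bigr => p _.
rewrite {1}[y]palgE mulr_sumr; apply: eq_bigr => q _.
exact: scale_pbaseM.
Qed.

(** The module and ring structures of [palg] are given separately; their compatibility is checked on
    the basis of paths. *)
Lemma palg_scaleAl c x y : (c *: x) * y = c *: (x * y).
Proof.
rewrite palg_scaleE mulr_suml palg_mulE scaler_sumr; apply: eq_bigr => p _.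
rewrite {1}[y]palgE mulr_sumr scaler_sumr; apply: eq_bigr => q _.
by rewrite scale_pbaseM scalerA mulrA.
Qed.

Lemma palg_scaleAr c x y : x * (c *: y) = c *: (x * y).
Proof.
rewrite palg_scaleE [in LHS](palgE x) mulr_suml palg_mulE scaler_sumr; apply: eq_bigr => p _.
rewrite mulr_sumr scaler_sumr; apply: eq_bigr => q _.
by rewrite scale_pbaseM scalerA mulrCA.
Qed.

Lemma pcoef_mulr x p u : pcoef (x * pbase k p) u =
  \sum_(q <- psupp x) pcoef x q * (pcat q p == Some u)%:R.
Proof.
rewrite {1}[x]palgE mulr_suml pcoef_sum; apply: eq_bigr => q _.
rewrite palg_scaleAl pcoefZ pbaseM; congr (_ * _).
by case: pcat => [r|]; rewrite ?pcoef0 ?pcoef_base.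
Qed.

Lemma pcoef_mull x p u : pcoef (pbase k p * x) u =
  \sum_(q <- psupp x) pcoef x q * (pcat p q == Some u)%:R.
Proof.
rewrite {1}[x]palgE mulr_sumr pcoef_sum; apply: eq_bigr => q _.
rewrite palg_scaleAr pcoefZ pbaseM; congr (_ * _).
by case: pcat => [r|]; rewrite ?pcoef0 ?pcoef_base.
Qed.

(** Serves for products with a fixed path: by cancellation at most one path of [x] contributes to a
    given coefficient. *)
Lemma pcoef_pick x (P : pred (qpath Q)) q : P q -> (forall q', P q' -> q' = q) ->
  \sum_(q' <- psupp x) pcoef x q' * (P q')%:R = pcoef x q.
Proof.
move=> Pq Puniq; have [qx|qx] := boolP (q \in psupp x).
  rewrite (bigD1_seq q) ?psupp_uniq //= Pq mulr1 big1 ?addr0 // => q' q'q.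
  by case Pq': (P q'); rewrite ?mulr0 //; move: q'q; rewrite (Puniq _ Pq') eqxx.
rewrite big_seq big1 => [|q' q'x].
  by apply/eqP; rewrite eq_sym -[_ == _]negbK -psuppP.
by case Pq': (P q'); rewrite ?mulr0 //; move: qx; rewrite -(Puniq _ Pq') q'x.
Qed.

Lemma pcoef_mulr_cat x p q u : pcat q p = Some u ->
  pcoef (x * pbase k p) u = pcoef x q.
Proof.
move=> qpu; rewrite pcoef_mulr (@pcoef_pick _ (fun q => pcat q p == Some u) q) ?qpu //.
by move=> q' /eqP q'pu; apply: pcat_injr q'pu qpu.
Qed.

Lemma pcoef_mull_cat x p q u : pcat p q = Some u ->
  pcoef (pbase k p * x) u = pcoef x q.
Proof.
move=> pqu; rewrite pcoef_mull (@pcoef_pick _ (fun q => pcat p q == Some u) q) ?pqu //.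
by move=> q' /eqP pq'u; apply: pcat_injl pq'u pqu.
Qed.

Lemma pcoef_mulr_neq0 x p u : pcoef (x * pbase k p) u != 0 ->
  exists2 q, pcat q p = Some u & pcoef x q != 0.
Proof.
rewrite pcoef_mulr => xpu.
have [[q /eqP]|none] := pselect (exists q, pcat q p == Some u).
  move=> qpu; exists q => //; apply: contraNneq xpu => xq.
  rewrite big1_seq // => q' _; case: eqP => [q'pu|]; rewrite ?mulr0 //.
  by rewrite (pcat_injr q'pu qpu) xq mul0r.
case/eqP: xpu; rewrite big1_seq // => q _.
by case: eqP => [qpu|]; rewrite ?mulr0 //; case: none; exists q; rewrite qpu.
Qed.

Lemma pcoef_mull_neq0 x p u : pcoef (pbase k p * x) u != 0 ->
  exists2 q, pcat p q = Some u & pcoef x q != 0.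
Proof.
rewrite pcoef_mull => xpu.
have [[q /eqP]|none] := pselect (exists q, pcat p q == Some u).
  move=> qpu; exists q => //; apply: contraNneq xpu => xq.
  rewrite big1_seq // => q' _; case: eqP => [q'pu|]; rewrite ?mulr0 //.
  by rewrite (pcat_injl q'pu qpu) xq mul0r.
case/eqP: xpu; rewrite big1_seq // => q _.
by case: eqP => [qpu|]; rewrite ?mulr0 //; case: none; exists q; rewrite qpu.
Qed.

Lemma pcoef_vertl v x q : pcoef (e v * x) q = if v == origin q then pcoef x q else 0.
Proof.
case: eqP => [->|vq]; first by rewrite (pcoef_mull_cat _ (q := q)) ?pcat_vpathl.
apply: contra_not_eq vq => /pcoef_mull_neq0[q' /pcat_inv[vq' qo _ _] _].
by rewrite qo.
Qed.

Lemma pcoef_vertr v x q : pcoef (x * e v) q = if v == terminus q then pcoef x q else 0.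
Proof.
case: eqP => [->|vq]; first by rewrite (pcoef_mulr_cat _ (q := q)) ?pcat_vpathr.
apply: contra_not_eq vq => /pcoef_mulr_neq0[q' /pcat_inv[vq' _ _ qt] _].
by rewrite qt.
Qed.

Lemma vertM (v : vertex Q) : e v * e v = e v.
Proof. by rewrite pbaseM pcat1p eqxx. Qed.

Lemma vert_neq (v v' : vertex Q) : v != v' -> e v * e v' = 0.
Proof. by move=> vv'; rewrite pbaseM pcat1p (negPf vv'). Qed.

Lemma pbase_neq0 p : pbase k p != 0.
Proof.
by apply/eqP => /(congr1 (fun x => pcoef x p))/eqP; rewrite pcoef_base pcoef0 eqxx oner_eq0.
Qed.

Lemma vertl_base p v : e v * pbase k p = if v == origin p then pbase k p else 0.
Proof. by rewrite pbaseM pcat1p; case: eqP. Qed.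

Lemma vertr_base p v : pbase k p * e v = if v == terminus p then pbase k p else 0.
Proof. by rewrite pbaseM pcatp1; case: eqP. Qed.

Lemma sum_vert : \sum_(v : vertex Q) e v = 1 :> R.
Proof. by apply: eq_bigr => v _; rewrite unlock. Qed.

Section Tip.
Variable le : rel (qpath Q).
Hypothesis le_adm : admissible_order le.
Let le_wo := admissible_wo le_adm.

Lemma tip_uniq x p q : is_tip le x p -> is_tip le x q -> p = q.
Proof. by move=> [px pm] [qx qm]; apply: (wo_anti le_wo); auto. Qed.

Lemma tipZ x p c : c != 0 -> is_tip le x p -> is_tip le (c *: x) p.
Proof.
move=> c0 [xp xmax]; split=> [|q]; first by rewrite pcoefZ mulf_neq0.
by rewrite pcoefZ mulf_eq0 negb_or => /andP[_ /xmax].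
Qed.

Lemma tip_mull x p q u : is_tip le x q -> pcat p q = Some u ->
  is_tip le (pbase k p * x) u.
Proof.
move=> [xq qmax] pqu; split; first by rewrite (pcoef_mull_cat _ pqu).
move=> w /pcoef_mull_neq0[r prw xr].
by apply: (adm_l le_adm pqu prw); apply: qmax.
Qed.

(** The vertex that fixes [x] on the right must be the terminus of every path occurring in [x],
    hence of its tip. *)
Lemma uniform_terminus x p : uniform x -> is_tip le x p -> x * e (terminus p) = x.
Proof.
move=> [_ [u [v xE]]] [xp _].
have xv : x * e v = x by rewrite {1}xE -!mulrA vertM mulrA -xE.
have : pcoef (x * e v) p != 0 by rewrite xv.
rewrite pcoef_vertr; case: (v =P terminus p) => [<- _|_]; first exact: xv.
by case/eqP.
Qed.
End Tip.

Lemma idealZ (I : ideal R) c x : x \in (I : zmodClosed R) -> c *: x \in (I : zmodClosed R).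
Proof.
move=> xI; rewrite -[x]mul1r -palg_scaleAl; exact: idealMl.
Qed.

(** * Monomial ideals and the tips of a Groebner basis *)

Section MonomialIdeal.
Variable P : set (qpath Q).
Hypothesis P_closed : forall p q, P p -> Defs.pdiv p q -> P q.

Definition mono_pred : {pred R} := fun x => `[< forall p, pcoef x p != 0 -> P p >].

Lemma mono_closed : zmod_closed mono_pred.
Proof.
split; first by apply/asboolP => p; rewrite pcoef0 eqxx.
move=> x y /asboolP xP /asboolP yP; apply/asboolP => p.
rewrite pcoefB; have [xp|/xP//] := eqVneq (pcoef x p) 0.
by rewrite xp sub0r oppr_eq0 => /yP.
Qed.

HB.instance Definition _ := GRing.isZmodClosed.Build R mono_pred mono_closed.

Lemma mono_Ml a x : x \in mono_pred -> a * x \in mono_pred.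
Proof.
move=> /asboolP xP; rewrite [a]palgE mulr_suml; apply: rpred_sum => q _.
apply/asboolP => p; rewrite palg_scaleAl pcoefZ.
have [->|/pcoef_mull_neq0[r qrp /xP rP] _] := eqVneq (pcoef (pbase k q * x) p) 0.
  by rewrite mulr0 eqxx.
apply: P_closed rP _; exists q, (vpath (terminus p)), p; split=> //.
exact: pcat_vpathr.
Qed.

Lemma mono_Mr a x : x \in mono_pred -> x * a \in mono_pred.
Proof.
move=> /asboolP xP; rewrite [a]palgE mulr_sumr; apply: rpred_sum => q _.
apply/asboolP => p; rewrite palg_scaleAr pcoefZ.
have [->|/pcoef_mulr_neq0[r rqp /xP rP] _] := eqVneq (pcoef (x * pbase k q) p) 0.
  by rewrite mulr0 eqxx.
apply: P_closed rP _; exists (vpath (origin r)), q, r; split=> //.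
exact: pcat_vpathl.
Qed.

Definition mono_ideal : ideal R := @Ideal R mono_pred mono_Ml mono_Mr.
End MonomialIdeal.

Section Groebner.
Variables (le : rel (qpath Q)) (I : ideal R).
Hypothesis le_adm : admissible_order le.

Lemma pdiv_trans p q r : Defs.pdiv p q -> Defs.pdiv q r -> Defs.pdiv p r.
Proof.
move=> [a [b [u [ap ub]]]] [c [d [w [cq wd]]]].
have [cu cuE cub] := pcat_assocV ub cq.
have [ca caE cap] := pcat_assocV ap cuE.
have [bd bdE cubd] := pcat_assoc cub wd.
by exists ca, bd, cu.
Qed.

(** The elements supported on multiples of tips of [G] form an ideal. It contains the tips of [G],
    hence the ideal generated by all tips of [I], hence the path [p]. *)
Lemma groebner_tip_div G p : groebner_basis le I G ->
  (exists2 x, x \in (I : zmodClosed R) & is_tip le x p) ->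
  exists g t, [/\ G g, is_tip le g t & Defs.pdiv t p].
Proof.
move=> [_ genE] [x xI xp].
pose P : set (qpath Q) := fun q => exists g t, [/\ G g, is_tip le g t & Defs.pdiv t q].
have Pc q r : P q -> Defs.pdiv q r -> P r.
  by move=> [g [t [Gg gt tq]]] qr; exists g, t; split=> //; apply: pdiv_trans qr.
have : generated_ideal (tips le (fun x => x \in (I : zmodClosed R))) (pbase k p).
  by move=> J; apply; exists x, p.
rewrite -genE => /(_ (mono_ideal Pc)) pJ.
have : pbase k p \in mono_pred P.
  apply: pJ => _ [g [t [Gg gt ->]]]; apply/asboolP => q.
  rewrite pcoef_base; case: (t =P q) => [<- _|]; last by rewrite eqxx.
  exists g, t; split=> //.
  exists (vpath (origin t)), (vpath (terminus t)), t.
  by rewrite pcat_vpathl pcat_vpathr.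
by move=> /asboolP; apply; rewrite pcoef_base eqxx oner_neq0.
Qed.

(** A tip [t] of [G] is divisible by a tip [t0] of [G0], which is divisible by a tip [t1] of [G].
    Tip-reducedness forces [t1 = t], so [t] is no longer than [t0]. *)
Lemma tip_reduced_bounded G : groebner_basis le I G -> tip_reduced le G ->
  (exists G0 : set R, finite_set G0 /\ groebner_basis le I G0) ->
  exists n, forall g t, G g -> is_tip le g t -> (plength t <= n)%N.
Proof.
move=> G_basis [_ G_red] [G0 [/finite_seqP[s sG0] G0_basis]].
(* Bounding all paths that occur in [x] avoids selecting its tip. *)
pose len (x : R) := \max_(q <- psupp x) plength q.
exists (\max_(x <- s) len x) => g t Gg gt.
have [|g0 [t0 [G0g0 g0t0 t0t]]] := groebner_tip_div (p := t) G0_basis.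
  by exists g => //; apply: (proj1 G_basis).
have [|g1 [t1 [Gg1 g1t1 t1t0]]] := groebner_tip_div (p := t0) G_basis.
  by exists g0 => //; apply: (proj1 G0_basis).
have gE := G_red _ _ _ _ Gg1 Gg g1t1 gt (pdiv_trans t1t0 t0t).
move: g1t1; rewrite gE => /(tip_uniq le_adm gt) tE.
have pdiv_len p q : Defs.pdiv p q -> (plength p <= plength q)%N.
  move=> [a [b [u [/pcat_plength + /pcat_plength ->]]]] => ->.
  by rewrite -addnA addnCA leq_addr.
apply: (@leq_trans (plength t0)); first by rewrite tE pdiv_len.
have g0s : g0 \in s by move: G0g0; rewrite sG0.
apply: (@leq_trans (len g0)); last by apply: (leq_bigmax_seq (F := len)).
by apply: (leq_bigmax_seq (F := @plength Q)); rewrite // psuppP; case: g0t0.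
Qed.
End Groebner.
End PathAlgebraLemmas.

(** * Coordinates in coproducts *)

Section RightModules.
Variables (A : pzRingType) (N : lmodType A^c).
Implicit Types (x y : N) (r s : A).

Lemma ractDl x y r : (x + y) ** r = x ** r + y ** r.
Proof. exact: scalerDr. Qed.
Lemma ractBl x y r : (x - y) ** r = x ** r - y ** r.
Proof. exact: scalerBr. Qed.
Lemma ract0l r : (0 : N) ** r = 0.
Proof. exact: scaler0. Qed.
Lemma ractDr x r s : x ** (r + s) = x ** r + x ** s.
Proof. exact: scalerDl. Qed.
Lemma ractBr x r s : x ** (r - s) = x ** r - x ** s.
Proof. exact: scalerBl. Qed.
Lemma ract0r x : x ** 0 = 0.
Proof. exact: scale0r. Qed.
Lemma ract1 x : x ** 1 = x.
Proof. exact: scale1r. Qed.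
Lemma ractA x r s : x ** r ** s = x ** (r * s).
Proof. exact: scalerA. Qed.
Lemma ract_suml (J : Type) (t : seq J) (P : pred J) (F : J -> N) r :
  (\sum_(j <- t | P j) F j) ** r = \sum_(j <- t | P j) F j ** r.
Proof. exact: scaler_sumr. Qed.
Lemma ract_sumr (J : Type) (t : seq J) (P : pred J) (F : J -> A) x :
  x ** (\sum_(j <- t | P j) F j) = \sum_(j <- t | P j) x ** F j.
Proof. exact: scaler_suml. Qed.
Lemma linear_ract (N' : lmodType A^c) (f : {linear N -> N'}) x r :
  f (x ** r) = f x ** r.
Proof. exact: linearZ. Qed.

Section Coprod.
Variables (T : choiceType) (f : T -> N).
Implicit Types w : coprod f.

Lemma ccomp_ract w r i : ccomp (w ** r) i = ccomp w i ** r.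
Proof. exact: ccompZ. Qed.

Lemma ccomp0 i : ccomp (0 : coprod f) i = 0.
Proof. exact: mcoeff0. Qed.

Lemma ccomp_sum (J : Type) (t : seq J) (F : J -> coprod f) i :
  ccomp (\sum_(j <- t) F j) i = \sum_(j <- t) ccomp (F j) i.
Proof. by apply: (big_morph (fun w => ccomp w i)) => [x y|]; [apply: ccompD | apply: ccomp0]. Qed.

Lemma ccomp_cinj i j r : ccomp (cinj f i r) j = if i == j then f i ** r else 0.
Proof. by rewrite [LHS]mcoeffU; case: eqP. Qed.

Lemma cinj_ract i r s : cinj f i r ** s = cinj f i (r * s).
Proof.
apply: coprodP => j; rewrite ccomp_ract !ccomp_cinj.
by case: eqP => _; rewrite ?ract0l // ractA.
Qed.

Lemma csum_cinj i r : csum (cinj f i r) = f i ** r.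
Proof.
rewrite (csumw (d := [fset i]%fset)); last exact: msuppU_le.
by rewrite big_seq_fset1 ccomp_cinj eqxx.
Qed.
End Coprod.
End RightModules.

(** * Coordinates with respect to the basis of a coproduct *)

Section FreeFamilies.
Variables (k : fieldType) (Q : quiver).
Local Notation R := (palg k Q).
Local Notation e v := (pbase k (vpath v)).

(* Equivalently, the maps [v_i R -> f_i R] are isomorphisms. *)
Definition free_family (N : lmodType R^c) (T : Type) (f : T -> N) (v : T -> vertex Q) :=
  forall i, f i = f i ** e (v i) /\ forall r, f i ** r = 0 -> e (v i) * r = 0.

Variables (N : lmodType R^c) (T : choiceType) (f : T -> N) (v : T -> vertex Q).
Implicit Types (w : coprod f) (i j : T) (p q u : qpath Q) (r s : R) (c : k).

(** For a free family this is the unique representative in [v_i R] of the [i]-th component; the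
    default [0] is then never reached. *)
Definition ccr w i : R := xget 0 [set r | is_ccoord w i r]%classic.

Lemma ccoefE w b : ccoef w b = pcoef (ccr w b.1) b.2.
Proof. by []. Qed.

Hypothesis f_free : free_family f v.

Lemma free_unit i : f i = f i ** e (v i).
Proof. by have [] := f_free i. Qed.

Lemma free_neq0 i : f i != 0.
Proof.
apply/eqP => fi0; have [_ /(_ 1)] := f_free i.
rewrite fi0 ract0l mulr1 => /(_ erefl)/eqP.
by rewrite (negPf (pbase_neq0 _ _)).
Qed.

(** Distinct vertices are orthogonal idempotents, so a second vertex fixing [f i] would make [f i]
    vanish. *)
Lemma free_vertex i (u : vertex Q) : f i = f i ** e u -> u = v i.
Proof.
move=> fu; apply: contra_eq (free_neq0 i) => uv.
by rewrite (free_unit i) fu ractA vert_neq // ract0r eqxx.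
Qed.

Lemma free_inj i r s : f i ** r = f i ** s -> e (v i) * r = e (v i) * s.
Proof.
move=> rs; apply/eqP; rewrite -subr_eq0 -mulrBr; apply/eqP.
by apply: (proj2 (f_free i)); rewrite ractBr rs subrr.
Qed.

(** Any known representative becomes the canonical one after multiplication by [e (v i)]; all rules
    for coordinates below follow from this. *)
Lemma ccr_eq w i r : ccomp w i = f i ** r -> ccr w i = e (v i) * r.
Proof.
move=> wi; rewrite /ccr; apply: xget_unique.
  split; first by rewrite wi [in LHS]free_unit ractA.
  by exists (v i); rewrite ?mulrA ?vertM //; apply: free_unit.
move=> s [wis [u fu ->]]; rewrite (free_vertex fu).
by rewrite -(free_inj (etrans (esym wi) wis)).
Qed.

Lemma ccompE w i : ccomp w i = f i ** ccr w i.
Proof.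
by have [r rP] := ccompP w i; rewrite (ccr_eq rP) -ractA -free_unit.
Qed.

Lemma ccr_v w i : e (v i) * ccr w i = ccr w i.
Proof. exact/esym/ccr_eq/ccompE. Qed.

Lemma ccrD w w' i : ccr (w + w') i = ccr w i + ccr w' i.
Proof.
rewrite (@ccr_eq _ _ (ccr w i + ccr w' i)); first by rewrite mulrDr !ccr_v.
by rewrite ccompD ractDr -!ccompE.
Qed.

Lemma ccrB w w' i : ccr (w - w') i = ccr w i - ccr w' i.
Proof.
rewrite (@ccr_eq _ _ (ccr w i - ccr w' i)); first by rewrite mulrBr !ccr_v.
by rewrite ccompB ractBr -!ccompE.
Qed.

Lemma ccr0 i : ccr 0 i = 0.
Proof. by rewrite (@ccr_eq _ _ 0) ?mulr0 // ccomp0 ract0r. Qed.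

Lemma ccr_ract w r i : ccr (w ** r) i = ccr w i * r.
Proof.
rewrite (@ccr_eq _ _ (ccr w i * r)); first by rewrite mulrA ccr_v.
by rewrite ccomp_ract -ractA -ccompE.
Qed.

Lemma ccr_cinj i r j : ccr (cinj f i r) j = if i == j then e (v i) * r else 0.
Proof.
rewrite (@ccr_eq _ _ (if i == j then r else 0)) ?ccomp_cinj; case: eqP => [->|_] //.
  by rewrite mulr0.
by rewrite ract0r.
Qed.

Lemma ccoefD w w' b : ccoef (w + w') b = ccoef w b + ccoef w' b.
Proof. by rewrite !ccoefE ccrD pcoefD. Qed.
Lemma ccoefB w w' b : ccoef (w - w') b = ccoef w b - ccoef w' b.
Proof. by rewrite !ccoefE ccrB pcoefB. Qed.
Lemma ccoef0 b : ccoef (0 : coprod f) b = 0.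
Proof. by rewrite !ccoefE ccr0 pcoef0. Qed.
Lemma ccoef_sum (J : Type) (t : seq J) (F : J -> coprod f) b :
  ccoef (\sum_(j <- t) F j) b = \sum_(j <- t) ccoef (F j) b.
Proof. by apply: (big_morph (fun w => ccoef w b)) => [x y|]; [apply: ccoefD | apply: ccoef0]. Qed.
Lemma ccoefZ w c b : ccoef (w ** (c *: (1 : R))) b = c * ccoef w b.
Proof. by rewrite !ccoefE ccr_ract palg_scaleAr mulr1 pcoefZ. Qed.

Lemma ccoef_cinj i r b : ccoef (cinj f i r) b =
  if i == b.1 then pcoef (e (v i) * r) b.2 else 0.
Proof. by rewrite ccoefE ccr_cinj; case: eqP => _ //; rewrite pcoef0. Qed.

Lemma ccoef_valid w b : ccoef w b != 0 -> origin b.2 = v b.1.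
Proof.
rewrite ccoefE -ccr_v pcoef_vertl; case: (v b.1 =P _) => [->//|_].
by rewrite eqxx.
Qed.

Lemma coprod_eq w w' : (forall b, ccoef w b = ccoef w' b) -> w = w'.
Proof.
move=> ww'; apply: coprodP => i; rewrite !ccompE; congr (_ ** _).
by apply: palgP => p; apply: (ww' (i, p)).
Qed.

Definition csupp w : seq (T * qpath Q) := undup
  [seq (i, p) | i <- msupp (cval w : {malg N[T]}), p <- psupp (ccr w i)].

Lemma csuppP w b : (b \in csupp w) = (ccoef w b != 0).
Proof.
rewrite mem_undup; apply/allpairsPdep/idP => [[i [p [_ + ->]]]|].
  by rewrite psuppP.
case: b => i p wip; exists i, p; split=> //; last by rewrite psuppP.
rewrite -mcoeff_neq0; apply: contraNneq wip => wi0.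
have /free_inj : f i ** ccr w i = f i ** 0 by rewrite -ccompE ract0r.
by rewrite ccr_v mulr0 ccoefE /= => ->; rewrite pcoef0.
Qed.

Lemma csupp_uniq w : uniq (csupp w).
Proof. exact: undup_uniq. Qed.

Lemma coprodE w (t : seq (T * qpath Q)) : uniq t ->
  (forall b, ccoef w b != 0 -> b \in t) ->
  w = \sum_(b <- t) cinj f b.1 (ccoef w b *: pbase k b.2).
Proof.
move=> t_uniq wt; apply: coprod_eq => -[i p]; rewrite ccoef_sum.
have term b : ccoef (cinj f b.1 (ccoef w b *: pbase k b.2)) (i, p) =
    if b == (i, p) then ccoef w b else 0.
  rewrite ccoef_cinj /= palg_scaleAr pcoefZ pcoef_vertl pcoef_base.
  case: b => j q /=; rewrite xpair_eqE; case: eqP => [->|] //=.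
  case: (q =P p) => [->|] /=; last by case: eqP; rewrite mulr0.
  have [->|/ccoef_valid /= ->] := eqVneq (ccoef w (i, p)) 0; first by rewrite mul0r.
  by rewrite eqxx mulr1.
rewrite (eq_bigr _ (fun b _ => term b)) -big_mkcond /=.
have [ipt|ipt] := boolP ((i, p) \in t).
  by rewrite -big_filter filter_pred1_uniq // big_seq1.
rewrite big1_seq => [|b /andP[/eqP -> bt]]; last by rewrite bt in ipt.
by apply/eqP; apply: contraNT ipt => /wt.
Qed.

Lemma csumE w : csum w = \sum_(b <- csupp w) f b.1 ** (ccoef w b *: pbase k b.2).
Proof.
rewrite {1}(@coprodE w (csupp w)) ?csupp_uniq // => [|b]; last by rewrite csuppP.
by rewrite raddf_sum; apply: eq_bigr => b _; apply: csum_cinj.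
Qed.

Lemma ccoef_ract_cat w i p q u : pcat q p = Some u ->
  ccoef (w ** pbase k p) (i, u) = ccoef w (i, q).
Proof. by move=> qpu; rewrite !ccoefE ccr_ract (pcoef_mulr_cat _ qpu). Qed.

Lemma ccoef_ract_neq0 w i p u : ccoef (w ** pbase k p) (i, u) != 0 ->
  exists2 q, pcat q p = Some u & ccoef w (i, q) != 0.
Proof. by rewrite ccoefE ccr_ract => /pcoef_mulr_neq0. Qed.

Lemma coprodIP (I : ideal R) w :
  w \in coprodI_pred f I <-> forall i, ccr w i \in (I : zmodClosed R).
Proof.
split=> [/asboolP wI i|wI]; first by have [r rI /ccr_eq ->] := wI i; apply: idealMl.
by apply/asboolP => i; exists (ccr w i) => //; apply: ccompE.
Qed.
End FreeFamilies.

(** * Tips in coproducts *)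

Section Orders.
Variables (k : fieldType) (Q : quiver) (le : rel (qpath Q)).
Hypothesis le_adm : admissible_order le.
Local Notation R := (palg k Q).
Local Notation e v := (pbase k (vpath v)).

(* The basis element [f_i p] is the pair [(i, p)], subject to [p] starting at [v_i]. *)
Definition valid (T : Type) (v : T -> vertex Q) (b : T * qpath Q) := origin b.2 = v b.1.

(** These are the properties of basis orders that pass from one stage to the next. They concern
    valid pairs only, since other pairs name no basis element. [go_same] lets tips in one coordinate
    be read off in [R]; [go_r] makes tips compatible with right multiplication. *)
Record good_order (T : Type) (v : T -> vertex Q)
    (ord : T * qpath Q -> T * qpath Q -> Prop) : Prop := GoodOrder {
  go_total : forall b b', valid v b -> valid v b' -> ord b b' \/ ord b' b;
  go_anti : forall b b', valid v b -> valid v b' -> ord b b' -> ord b' b -> b = b';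
  go_trans : forall b' b b'', valid v b -> valid v b' -> valid v b'' ->
    ord b b' -> ord b' b'' -> ord b b'';
  go_min : forall A : set (T * qpath Q), (forall b, A b -> valid v b) ->
    (exists b, A b) -> exists2 b, A b & forall b', A b' -> ord b b';
  go_same : forall i p q, valid v (i, p) -> valid v (i, q) ->
    ord (i, p) (i, q) <-> le p q;
  go_r : forall i j p q s ps qs, valid v (i, p) -> valid v (j, q) ->
    pcat p s = Some ps -> pcat q s = Some qs ->
    ord (i, p) (j, q) -> ord (i, ps) (j, qs)
}.

Lemma pcat_valid (T : Type) (v : T -> vertex Q) i p s u :
  pcat p s = Some u -> valid v (i, p) <-> valid v (i, u).
Proof. by move=> /pcat_inv[_ uo _ _]; rewrite /valid /= uo. Qed.

Section Tips.
Variables (N : lmodType R^c) (T : choiceType) (f : T -> N) (v : T -> vertex Q).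
Hypothesis f_free : free_family f v.
Variable ord : T * qpath Q -> T * qpath Q -> Prop.
Hypothesis ord_good : good_order v ord.
Implicit Types w : coprod f.

Lemma ctip_valid w b : is_ctip ord w b -> valid v b.
Proof. by case=> /(ccoef_valid f_free). Qed.

Lemma ctip_uniq w b c : is_ctip ord w b -> is_ctip ord w c -> b = c.
Proof.
move=> wb wc.
apply: (go_anti ord_good) (ctip_valid wb) (ctip_valid wc) _ _; case: wb wc => [b0 bm] [c0 cm].
  exact: cm.
exact: bm.
Qed.

Lemma ctip_neq0 w b : is_ctip ord w b -> w <> 0.
Proof. by case=> + _ w0; rewrite w0 (ccoef0 f_free) eqxx. Qed.

Lemma ctip_ex w : w <> 0 -> exists b, is_ctip ord w b.
Proof.
move=> w0; have wv b : b \in csupp w -> valid v b.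
  by rewrite (csuppP f_free) => /(ccoef_valid f_free).
have [|||b bw bmax] := @seq_max _ ord (csupp w).
- by move=> b c /wv bv /wv cv; apply: (go_total ord_good).
- by move=> b c d /wv bv /wv cv /wv dv; apply: (go_trans ord_good).
- move=> sw; apply: w0; apply: (coprod_eq f_free) => b; rewrite (ccoef0 f_free).
  by apply/eqP; apply: contraT; rewrite -(csuppP f_free) sw.
exists b; split; first by rewrite -(csuppP f_free).
by move=> c; rewrite -(csuppP f_free) => /bmax.
Qed.

Lemma ctip_ract w b p u : is_ctip ord w b -> pcat b.2 p = Some u ->
  is_ctip ord (w ** pbase k p) (b.1, u).
Proof.
case: b => i q wb /= qpu; have bv := ctip_valid wb; case: wb => w0 wm; split.
  by rewrite (ccoef_ract_cat f_free _ _ qpu).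
move=> [j u'] /(ccoef_ract_neq0 f_free)[q' q'pu' wjq'].
apply: (go_r ord_good) q'pu' qpu (wm _ wjq') => //.
exact: (ccoef_valid f_free wjq').
Qed.

Lemma ctip_cinj i r p : e (v i) * r = r -> is_tip le r p ->
  is_ctip ord (cinj f i r) (i, p).
Proof.
move=> vr [rp rm]; have ov q : pcoef r q != 0 -> origin q = v i.
  by rewrite -vr pcoef_vertl; case: (v i =P _) => //; rewrite eqxx.
split=> [|[j q]]; rewrite (ccoef_cinj f_free) /= ?eqxx vr //.
case: (i =P j) => [<-|]; last by rewrite eqxx.
move=> rq; apply/(go_same ord_good); try exact: ov.
exact: rm.
Qed.

(** Pairwise distinct tips cannot all cancel: the largest one receives a contribution from a single
    summand. The scalar [a b] acts as [a b *: 1], the modules having only an action of [R]. *)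
Lemma sum_ctip (B : eqType) (s : seq B) (x : B -> coprod f) (phi : B -> T * qpath Q)
    (a : B -> k) :
  uniq s -> s <> [::] -> {in s, forall b, is_ctip ord (x b) (phi b)} ->
  {in s &, injective phi} -> {in s, forall b, a b != 0} ->
  exists2 b, b \in s & {in s, forall b', ord (phi b') (phi b)} /\
    is_ctip ord (\sum_(b <- s) x b ** (a b *: (1 : R))) (phi b).
Proof.
move=> s_uniq s0 xt phi_inj a0; have pv b : b \in s -> valid v (phi b).
  by move=> /xt/ctip_valid.
have [|||b bs bmax] := @seq_max _ (fun b b' => ord (phi b) (phi b')) s.
- by move=> b c /pv bv /pv cv; apply: (go_total ord_good).
- by move=> b c d /pv bv /pv cv /pv dv; apply: (go_trans ord_good).
- exact: s0.
exists b => //; split=> //; split.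
  rewrite (ccoef_sum f_free) (bigD1_seq b) //= big1_seq ?addr0 => [|b' /andP[b'b b's]].
    by rewrite (ccoefZ f_free) mulf_neq0 ?a0 //; have [] := xt b bs.
  rewrite (ccoefZ f_free); apply/eqP; rewrite mulf_eq0; apply/orP; right.
  (* If [phi b] occurred in [x b'], it would be at most [phi b'], hence equal to it by maximality,
     against injectivity. *)
  apply: contraNT b'b => /(proj2 (xt _ b's)) bb'; apply/eqP/phi_inj => //.
  by apply: (go_anti ord_good) => //; [apply: pv..|apply: bmax].
move=> c; rewrite (ccoef_sum f_free) => sc.
have [b' b's xc] : exists2 b', b' \in s & ccoef (x b') c != 0.
  apply: contrapT => none; case/eqP: sc; rewrite big1_seq // => b' /andP[_ b's].
  rewrite (ccoefZ f_free); apply/eqP; rewrite mulf_eq0; apply/orP; right.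
  by apply: contraT => xc; case: none; exists b'.
have cv := ccoef_valid f_free xc.
apply: (go_trans ord_good (b' := phi b')) (bmax _ b's) => //; try exact: pv.
by apply: (proj2 (xt _ b's)).
Qed.

(** * Right tip-reduced families and reduction *)

Section Tipped.
Variables (J : choiceType) (h : J -> coprod f) (vh : J -> vertex Q).
Variable tp : J -> T * qpath Q.

(** Carrying the tips as a function [tp] avoids a choice at each use, and [tipped_red] is right
    tip-reducedness stated on indices. *)
Record tipped : Prop := Tipped {
  tipped_tip : forall j, is_ctip ord (h j) (tp j);
  tipped_unit : forall j, h j = h j ** e (vh j);
  tipped_red : forall j j', (tp j).1 = (tp j').1 -> pldiv (tp j).2 (tp j').2 -> j = j'
}.

Hypothesis h_tipped : tipped.
Let h_tip := tipped_tip h_tipped.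
Implicit Types z : coprod h.

Lemma tipped_terminus j : terminus (tp j).2 = vh j.
Proof.
have [+ _] := h_tip j; rewrite (tipped_unit h_tipped j) ccoefE (ccr_ract f_free).
by rewrite pcoef_vertr; case: (vh j =P _) => //; rewrite eqxx.
Qed.

(* The tip of [h_j p]; the default value [b.2] is reached only for invalid [b]. *)
Definition tip_of (b : J * qpath Q) : T * qpath Q :=
  ((tp b.1).1, odflt b.2 (pcat (tp b.1).2 b.2)).

Lemma tip_ofE b : valid vh b -> pcat (tp b.1).2 b.2 = Some (tip_of b).2.
Proof.
move=> bv; have [|u uE] := @pcat_ex _ (tp b.1).2 b.2; first by rewrite tipped_terminus bv.
by rewrite uE /tip_of /= uE.
Qed.

Lemma tip_of_cat j p u : pcat (tp j).2 p = Some u -> tip_of (j, p) = ((tp j).1, u).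
Proof. by rewrite /tip_of /= => ->. Qed.

Lemma valid_cat j p u : pcat (tp j).2 p = Some u -> valid vh (j, p).
Proof. by move=> /pcat_inv[jp _ _ _]; rewrite /valid -tipped_terminus jp. Qed.

Lemma tip_of_ctip b : valid vh b -> is_ctip ord (h b.1 ** pbase k b.2) (tip_of b).
Proof. by move=> bv; apply: ctip_ract (tip_ofE bv). Qed.

Lemma tip_of_valid b : valid vh b -> valid v (tip_of b).
Proof. by move=> /tip_of_ctip/ctip_valid. Qed.

(** Two tip paths that begin the same path are comparable under left division, so tip-reducedness
    identifies their indices and left cancellation the cofactors. *)
Lemma tip_of_inj b b' : valid vh b -> valid vh b' -> tip_of b = tip_of b' -> b = b'.
Proof.
move=> bv b'v bb'; have := tip_ofE bv; have := tip_ofE b'v; rewrite -bb' => b'E bE.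
have i1 : (tp b.1).1 = (tp b'.1).1 by apply: (congr1 fst bb').
have d : pldiv (tp b.1).2 (tip_of b).2 by exists b.2.
have d' : pldiv (tp b'.1).2 (tip_of b).2 by exists b'.2.
have jj : b.1 = b'.1.
  have [le12|/ltnW le21] := leqP (plength (tp b.1).2) (plength (tp b'.1).2).
    exact: (tipped_red h_tipped) i1 (pldiv_total d d' le12).
  exact/esym/((tipped_red h_tipped) _ _ (esym i1) (pldiv_total d' d le21)).
case: b b' jj b'E bE {bv b'v bb' i1 d d'} => j p [j' p'] /= <- b'E bE.
by rewrite (pcat_injl bE b'E).
Qed.

Lemma ccoef_tip_of b : valid vh b ->
  ccoef (h b.1 ** pbase k b.2) (tip_of b) = ccoef (h b.1) (tp b.1).
Proof.
move=> bv; rewrite {1}[tip_of b]surjective_pairing (ccoef_ract_cat f_free _ _ (tip_ofE bv)).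
by rewrite /tip_of /= -surjective_pairing.
Qed.

Lemma ract_scale (N' : lmodType R^c) (x : N') (a : k) (r : R) :
  x ** (a *: r) = x ** r ** (a *: (1 : R)).
Proof. by rewrite ractA palg_scaleAr mulr1. Qed.

(** If [r'] is nonzero, the terms of [h j ** r'] have distinct tips, so [sum_ctip] gives the sum a
    tip. Coproducts over [h] thus have coordinates again. *)
Lemma tipped_free : free_family h vh.
Proof.
move=> j; split; first exact: (tipped_unit h_tipped).
move=> r hr; apply: contrapT => r0; pose r' := e (vh j) * r.
pose s := [seq (j, p) | p <- psupp r'].
have hr' : h j ** r' = 0 by rewrite /r' -ractA -(tipped_unit h_tipped).
have sv b : b \in s -> valid vh b.
  move=> /mapP[p + ->]; rewrite psuppP pcoef_vertl /valid /=.
  by case: (vh j =P _) => //; rewrite eqxx.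
have [|||||b _ [_]] := @sum_ctip _ s (fun b => h b.1 ** pbase k b.2) tip_of
    (fun b => pcoef r' b.2).
- by rewrite map_inj_uniq ?psupp_uniq // => p q [].
- move=> s0; apply: r0; rewrite [LHS]palgE -/r'.
  have /size0nil -> : size (psupp r') = 0%N by rewrite -(size_map (pair j)) -/s s0.
  by rewrite big_nil.
- by move=> b bs /=; apply/tip_of_ctip/sv.
- by move=> b b' /sv bv /sv b'v; apply: tip_of_inj.
- by move=> b /mapP[p + ->]; rewrite psuppP.
move/ctip_neq0; case; rewrite big_map -[RHS]hr' [in RHS](palgE r') ract_sumr.
by apply: eq_bigr => p _; rewrite [RHS]ract_scale.
Qed.

(** The last clause says more than that [csum z] is nonzero: no term of [z] has a tip above that of
    the sum. Bounds on the terms of a known sum come from it. *)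
Lemma csum_ctip z : z <> 0 -> exists b, [/\ valid vh b, ccoef z b != 0,
    is_ctip ord (csum z) (tip_of b)
  & forall b', ccoef z b' != 0 -> ord (tip_of b') (tip_of b)].
Proof.
move=> z0; have sv b : b \in csupp z -> valid vh b.
  by rewrite (csuppP tipped_free) => /(ccoef_valid tipped_free).
have [|||||b bz [bm bt]] := @sum_ctip _ (csupp z) (fun b => h b.1 ** pbase k b.2) tip_of
    (ccoef z).
- exact: csupp_uniq.
- move=> s0; apply: z0; apply: (coprod_eq tipped_free) => b; rewrite (ccoef0 tipped_free).
  by apply/eqP; apply: contraT; rewrite -(csuppP tipped_free) s0.
- by move=> b bs /=; apply/tip_of_ctip/sv.
- by move=> b b' /sv bv /sv b'v; apply: tip_of_inj.
- by move=> b; rewrite (csuppP tipped_free).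
exists b; split; [exact: sv | by rewrite -(csuppP tipped_free) | |].
  have -> // : csum z = \sum_(b <- csupp z) h b.1 ** pbase k b.2 ** (ccoef z b *: (1 : R)).
  by apply: etrans (csumE tipped_free z) _; apply: eq_bigr => c _; apply: ract_scale.
by move=> b'; rewrite -(csuppP tipped_free) => /bm.
Qed.

Lemma csum_eq0 z : csum z = 0 -> z = 0.
Proof. by move=> cz; apply: contrapT => /csum_ctip[b [_ _ /ctip_neq0]]. Qed.

Lemma csum_inj z z' : csum z = csum z' -> z = z'.
Proof. by move=> zz'; apply: subr0_eq; apply: csum_eq0; rewrite raddfB /= zz' subrr. Qed.

(** This is [next_ord] for an arbitrary family. *)
Definition tip_ord (b b' : J * qpath Q) : Prop :=
  exists c c', [/\ is_ctip ord (h b.1 ** pbase k b.2) c,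
                   is_ctip ord (h b'.1 ** pbase k b'.2) c' & ord c c'].

Lemma tip_ordE b b' : valid vh b -> valid vh b' ->
  tip_ord b b' <-> ord (tip_of b) (tip_of b').
Proof.
move=> bv b'v; split=> [[c [c' [bc b'c']]]|bb'].
  by rewrite (ctip_uniq bc (tip_of_ctip bv)) (ctip_uniq b'c' (tip_of_ctip b'v)).
by exists (tip_of b), (tip_of b'); split=> //; apply: tip_of_ctip.
Qed.

(** On valid pairs the order is pulled back along the injection [tip_of]. For [go_same] the common
    prefix [tp i] is cancelled; for [go_r] the factor [s] is moved out of [tip_of] by
    associativity. *)
Lemma tip_ord_good : good_order vh tip_ord.
Proof.
split.
- move=> b b' bv b'v; have [] := go_total ord_good (tip_of_valid bv) (tip_of_valid b'v).
    by left; apply/tip_ordE.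
  by right; apply/tip_ordE.
- move=> b b' bv b'v /tip_ordE h1 /tip_ordE h2; apply: tip_of_inj => //.
  by apply: (go_anti ord_good); [exact: tip_of_valid..| exact: h1 | exact: h2].
- move=> b' b b'' bv b'v b''v /tip_ordE h1 /tip_ordE h2; apply/tip_ordE => //.
  by apply: (go_trans ord_good (b' := tip_of b')); [exact: tip_of_valid..|exact: h1|exact: h2].
- move=> A Av [b Ab].
  have [||c [b0 Ab0 <-] bmin] := go_min ord_good (A := (tip_of @` A)%classic).
  + by move=> _ [b' Ab' <-]; apply: tip_of_valid; apply: Av.
  + by exists (tip_of b), b.
  exists b0 => // b' Ab'; apply/tip_ordE; [exact: Av..|].
  by apply: bmin; exists b'.
- move=> i p q pv qv; apply: iff_trans (tip_ordE pv qv) _.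
  have pE := tip_ofE pv; have qE := tip_ofE qv.
  rewrite (surjective_pairing (tip_of _)) (surjective_pairing (tip_of (i, q))).
  apply: iff_trans _ (adm_l_iff le_adm qE pE).
  apply: (go_same ord_good).
    by have := tip_of_valid pv; rewrite {1}[tip_of _]surjective_pairing.
  by have := tip_of_valid qv; rewrite {1}[tip_of _]surjective_pairing.
- move=> i j p q s ps qs pv qv psE qsE /(tip_ordE pv qv) pq.
  have psv := (pcat_valid vh i psE).1 pv; have qsv := (pcat_valid vh j qsE).1 qv.
  apply/tip_ordE => //.
  have [a aE pa] := pcat_assocV psE (tip_ofE psv).
  have [b bE qb] := pcat_assocV qsE (tip_ofE qsv).
  rewrite (surjective_pairing (tip_of (i, ps))) (surjective_pairing (tip_of (j, qs))).
  move: pq (tip_of_valid pv) (tip_of_valid qv); rewrite (tip_of_cat aE) (tip_of_cat bE) => pq av bv.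
  exact: (go_r ord_good) pa qb pq.
Qed.

(** Take the least tip [c] of an element of [K] outside the span and subtract the multiple of
    [h j ** p] that cancels it. The difference is again such an element, so its tip is at least [c];
    but it is at most [c], and the coefficient at [c] is zero. *)
Lemma span_reduce (K : set (coprod f)) :
  (forall x y, K x -> K y -> K (x - y)) -> (forall z, K (csum z)) ->
  (forall w c, K w -> is_ctip ord w c -> exists2 b, valid vh b & tip_of b = c) ->
  forall w, K w -> exists z, csum z = w.
Proof.
move=> K_sub K_h K_tip w Kw; apply: contrapT => w_no.
pose A c := exists w, [/\ K w, ~ (exists z, csum z = w) & is_ctip ord w c].
have A_ex x : K x -> ~ (exists z, csum z = x) -> exists2 c, is_ctip ord x c & A c.
  move=> Kx x_no; have [|c xc] := @ctip_ex x; last by exists c => //; exists x.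
  by move=> x0; apply: x_no; exists 0; rewrite raddf0.
have [||c [x [Kx x_no xc]] cmin] := go_min ord_good (A := A).
- by move=> c [x [_ _ /ctip_valid]].
- by have [c _ Ac] := A_ex w Kw w_no; exists c.
have [b bv bc] := K_tip _ _ Kx xc; have bt := tip_of_ctip bv.
(* The quotient of leading coefficients, so that the coefficient of [x - csum z0] at [c]
   vanishes. *)
pose a := ccoef x c / ccoef (h b.1) (tp b.1).
pose z0 := cinj h b.1 (a *: pbase k b.2).
have z0E : csum z0 = h b.1 ** pbase k b.2 ** (a *: (1 : R)).
  by rewrite csum_cinj [LHS]ract_scale.
have [||c' yc' Ac'] := A_ex (x - csum z0); first exact: K_sub.
  by move=> [z zE]; apply: x_no; exists (z + z0); rewrite raddfD /= zE subrK.
have cv := ctip_valid xc; have c'v := ctip_valid yc'.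
have c'c : c' = c.
  apply: (go_anti ord_good) => //; last exact: cmin.
  have [+ _] := yc'; rewrite (ccoefB f_free) z0E (ccoefZ f_free).
  have [->|xc'] := eqVneq (ccoef x c') 0; last by move=> _; apply: (proj2 xc).
  rewrite sub0r oppr_eq0 mulf_eq0 negb_or => /andP[_ hc'].
  by rewrite -bc; apply: (proj2 bt).
have [+ _] := yc'; rewrite c'c (ccoefB f_free) z0E (ccoefZ f_free) -bc.
rewrite (ccoef_tip_of bv) bc /a divfK ?subrr ?eqxx //.
by have [] := h_tip b.1.
Qed.
End Tipped.
End Tips.
End Orders.

(** * The next stage of the resolution *)

Section Join.
Variables (k : fieldType) (Q : quiver).
Local Notation R := (palg k Q).
Variables (N : lmodType R^c) (T : choiceType) (f : T -> N).
Variables (T1 T2 : choiceType) (g1 : T1 -> coprod f) (g2 : T2 -> coprod f).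

(** The families [f^n] and [f^n'] are tip-reduced only jointly, so tips are studied on their
    union. *)
Definition joinf (j : (T1 + T2)%type) : coprod f :=
  match j with inl i => g1 i | inr i => g2 i end.

Variable vh : (T1 + T2)%type -> vertex Q.
Hypothesis h_free : free_family joinf vh.

Lemma join_freel : free_family g1 (vh \o inl).
Proof. by move=> i; apply: (h_free (inl i)). Qed.

Lemma join_freer : free_family g2 (vh \o inr).
Proof. by move=> i; apply: (h_free (inr i)). Qed.

Lemma join_split (z : coprod joinf) :
  exists (a : coprod g1) (b : coprod g2), csum z = csum a + csum b.
Proof.
rewrite (csumE h_free).
apply: (big_ind (fun x => exists (a : coprod g1) (b : coprod g2), x = csum a + csum b)).
- by exists 0, 0; rewrite !raddf0 addr0.
- move=> _ _ [a [b ->]] [a' [b' ->]]; exists (a + a'), (b + b').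
  by rewrite !raddfD /= addrACA.
- move=> [[i|i] p] _ /=.
    by exists (cinj g1 i (ccoef z (inl i, p) *: pbase k p)), 0; rewrite raddf0 addr0 csum_cinj.
  by exists 0, (cinj g2 i (ccoef z (inr i, p) *: pbase k p)); rewrite raddf0 add0r csum_cinj.
Qed.

(** The clause on coefficients lets facts about the merged family be read back on [a]. *)
Lemma join_merge (a : coprod g1) (b : coprod g2) : exists z : coprod joinf,
  csum z = csum a + csum b /\ forall i p, ccoef z (inl i, p) = ccoef a (i, p).
Proof.
exists (\sum_(c <- csupp a) cinj joinf (inl c.1) (ccoef a c *: pbase k c.2) +
        \sum_(c <- csupp b) cinj joinf (inr c.1) (ccoef b c *: pbase k c.2)); split.
  rewrite raddfD /= !raddf_sum (csumE join_freel) (csumE join_freer).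
  by congr (_ + _); apply: eq_bigr => c _; apply: csum_cinj.
move=> i p; rewrite (ccoefD h_free) !(ccoef_sum h_free).
rewrite [X in _ + X]big1 ?addr0 => [|c _]; last by rewrite (ccoef_cinj h_free).
rewrite [in RHS](@coprodE _ _ _ _ _ _ join_freel a (csupp a)) ?csupp_uniq //; last first.
  by move=> c; rewrite (csuppP join_freel).
rewrite (ccoef_sum join_freel); apply: eq_bigr => c _.
by rewrite (ccoef_cinj h_free) (ccoef_cinj join_freel).
Qed.
End Join.

Lemma csum_coprodI (A : pzRingType) (I : ideal A) (N : lmodType A^c) (T J : choiceType)
    (f : T -> N) (h : J -> coprod f) (z : coprod h) :
  (forall j, h j \in coprodI_pred f I) -> csum z \in coprodI_pred f I.
Proof.
move=> hI; rewrite /csum; apply: rpred_sum => j _.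
by have [r ->] := ccompP z j; apply: coprodI_ract.
Qed.

Section Step.
Variables (k : fieldType) (Q : quiver) (le : rel (qpath Q)).
Hypothesis le_adm : admissible_order le.
Local Notation R := (palg k Q).
Local Notation e v := (pbase k (vpath v)).
Variables (I : ideal R) (G : set R).
Hypothesis G_basis : groebner_basis le I G.
Hypothesis G_unif : forall g, G g -> uniform g.

Let G_I g : G g -> g \in (I : zmodClosed R).
Proof. exact: (proj1 G_basis). Qed.

(** Take the shortest prefix of [p] that ends in a tip of [G]: a tip ending strictly inside it would
    give a shorter one. This is condition (3) in the definition of [X(p)]. *)
Lemma shortest_reducible p : (exists g t, [/\ G g, is_tip le g t & Defs.pdiv t p]) ->
  exists q, [/\ pldiv q p, exists g t, [/\ G g, is_tip le g t & prdiv t q]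
    & forall g t r s u, G g -> is_tip le g t ->
        pcat r t = Some u -> pcat u s = Some q -> plength s = 0%N].
Proof.
move=> [g [t [Gg gt [r [s [u [rtu usp]]]]]]].
pose P n := `[< exists q, [/\ plength q = n, pldiv q p &
  exists g t, [/\ G g, is_tip le g t & prdiv t q]] >].
have exP : exists n, P n.
  exists (plength u); apply/asboolP; exists u; split=> //; first by exists s.
  by exists g, t; split=> //; exists r.
case: (ex_minnP exP) => n /asboolP[q [qn qp qred]] nmin.
exists q; split=> // g' t' r' s' u' Gg' gt' rtu' usq'.
have /nmin : P (plength u').
  apply/asboolP; exists u'; split=> //; first by apply: pldiv_trans qp; exists s'.
  by exists g', t'; split=> //; exists r'.
by rewrite -qn (pcat_plength usq') -[X in (_ <= X)%N]addn0 leq_add2l leqn0 => /eqP.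
Qed.

Variables (N : lmodType R^c) (T : choiceType) (f : T -> N) (v : T -> vertex Q).
Hypothesis f_free : free_family f v.
Variable ord : T * qpath Q -> T * qpath Q -> Prop.
Hypothesis ord_good : good_order le v ord.

Lemma cinj_coprodI i r : r \in (I : zmodClosed R) -> cinj f i r \in coprodI_pred f I.
Proof.
move=> rI; apply/(coprodIP f_free) => j; rewrite (ccr_cinj f_free).
by case: eqP => _; rewrite ?rpred0 // idealMl.
Qed.

(** The coordinate of [w] that carries the tip lies in [I] and, by [go_same], has the tip path as
    its own tip. *)
Lemma coprodI_tip w c : w \in coprodI_pred f I -> is_ctip ord w c ->
  exists g t, [/\ G g, is_tip le g t & Defs.pdiv t c.2].
Proof.
case: c => i p wI wc; apply: (groebner_tip_div G_basis).
exists (ccr w i); first by move: wI => /(coprodIP f_free).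
have pv := ctip_valid f_free wc; case: wc => wp wm; split=> // q wq.
apply/(go_same ord_good _ pv); last exact: (wm (i, q)).
exact: (ccoef_valid f_free (w := w) (b := (i, q)) wq).
Qed.

Lemma ctip_cinj_mul i r g t u : G g -> is_tip le g t -> origin u = v i ->
  pcat r t = Some u -> is_ctip ord (cinj f i (pbase k r * g)) (i, u).
Proof.
move=> Gg gt uv rtu; apply: (ctip_cinj f_free ord_good); last exact: tip_mull gt rtu.
have [_ uo _ _] := pcat_inv rtu.
by rewrite mulrA vertl_base -uv uo eqxx.
Qed.

Variables (T' U' : choiceType) (sg : T' -> coprod f) (sg' : U' -> coprod f).
Local Notation h := (joinf sg sg').
Variables (vh : (T' + U')%type -> vertex Q) (tp : (T' + U')%type -> T * qpath Q).
Hypothesis h_tipped : tipped ord h vh tp.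
Hypothesis I_span : forall w, w \in coprodI_pred f I ->
  exists (a : coprod sg) (b : coprod sg'), w = csum a + csum b.
Hypothesis sg'_I : forall j, sg' j \in coprodI_pred f I.

Let h_free := tipped_free f_free ord_good h_tipped.
Let sg_free := join_freel h_free.
Let S := Stage ord sg sg'.
Let vg := vh \o inl.
Let tpg := tp \o inl.

Lemma sg_tipped : tipped ord sg vg tpg.
Proof.
split=> [j|j|j j' j1 j2]; first exact: (tipped_tip h_tipped (inl j)).
  exact: (tipped_unit h_tipped (inl j)).
by have [] : inl j = inl j' :> (T' + U')%type by apply: (tipped_red h_tipped).
Qed.

Lemma next_ord_good : good_order le vg (next_ord (S := S)).
Proof. exact: (tip_ord_good le_adm f_free ord_good sg_tipped). Qed.

Lemma join_inj (a : coprod sg) (b : coprod sg') : csum a + csum b = 0 -> a = 0.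
Proof.
move=> ab0; have [z [zE za]] := join_merge h_free a b.
have z0 : z = 0 by apply: (csum_eq0 f_free ord_good h_tipped); rewrite zE.
apply: (coprod_eq sg_free) => -[i p].
by rewrite -za z0 (ccoef0 h_free) (ccoef0 sg_free).
Qed.

(** Placing [r g] in the coordinate of [tp j] gives an element of the coproduct of the [f_i I] with
    tip path [u]. By [I_span] that tip is a multiple of some tip of the family, which then left
    divides [tp j] and so equals it. Hence [u] is already all of the path. *)
Lemma tip_reducible_end j r t s u g : G g -> is_tip le g t ->
  pcat r t = Some u -> pcat u s = Some (tp j).2 -> plength s = 0%N.
Proof.
move=> Gg gt rtu usp.
have jv := ctip_valid f_free (tipped_tip h_tipped j).
have [_ po _ _] := pcat_inv usp.
have wt : is_ctip ord (cinj f (tp j).1 (pbase k r * g)) ((tp j).1, u).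
  by apply: ctip_cinj_mul rtu => //; rewrite -po.
have [|a [b abE]] := I_span (w := cinj f (tp j).1 (pbase k r * g)).
  by apply: cinj_coprodI; apply: idealMl; apply: G_I.
have [z [zE _]] := join_merge h_free a b.
have [|c [cv _ ct _]] := @csum_ctip _ _ _ _ _ _ _ f_free _ ord_good _ _ _ _ h_tipped z.
  by move=> z0; apply: (ctip_neq0 f_free wt); rewrite abE -zE z0 raddf0.
have cu : tip_of tp c = ((tp j).1, u).
  by apply: (ctip_uniq f_free ord_good) wt; rewrite abE -zE.
have cE := tip_ofE f_free h_tipped cv; rewrite cu /= in cE.
have cj : c.1 = j.
  apply: (tipped_red h_tipped); first exact: (congr1 fst cu).
  by apply: (@pldiv_trans _ u); [exists c.2 | exists s].
move: cE; rewrite cj => /pcat_plength; rewrite (pcat_plength usp) => /eqP.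
by rewrite -addnA -[X in X == _]addn0 eqn_add2l eq_sym addn_eq0 => /andP[/eqP].
Qed.

(** Here [m] is the tip path of [csum w], and [q] its shortest prefix ending in a tip of [G]. It
    remains to see that [q] extends the tip path of the generator. *)
Lemma syzygy_tip (w : coprod sg) b : csum w \in coprodI_pred f I ->
  is_ctip (next_ord (S := S)) w b -> exists q m, [/\ Xset le G (tpg b.1).2 q,
    pcat (tpg b.1).2 b.2 = Some m & pldiv q m].
Proof.
move=> wI wb; have bv := ctip_valid sg_free wb.
have w0 := ctip_neq0 sg_free wb.
have [b' [b'v wb' b't b'm]] := csum_ctip f_free ord_good sg_tipped w0.
(* The tip of [w] for the pulled back order and the term that gives the tip of [csum w] are the
   same. *)
have bb' : b = b'.
  apply: (go_anti next_ord_good) => //.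
    by apply/(tip_ordE f_free ord_good sg_tipped) => //; apply: b'm; case: wb.
  by apply: (proj2 wb).
rewrite -{}bb' {b' b'v wb' b'm} in b't.
have bE := tip_ofE f_free sg_tipped bv.
have [q [qm qred qmin]] := shortest_reducible (coprodI_tip wI b't).
exists q, (tip_of tpg b).2; split=> //; split=> //.
have bm : pldiv (tpg b.1).2 (tip_of tpg b).2 by exists b.2.
(* If [q] is the shorter of the two prefixes of [m], [tip_reducible_end] shows that they
   coincide. *)
have [|/ltnW pq] := leqP (plength (tpg b.1).2) (plength q).
  by move=> pq; apply: pldiv_total bm qm pq.
have [s qs] := pldiv_total qm bm pq.
have [g [t [Gg gt [r rtq]]]] := qred.
have s0 := tip_reducible_end (j := inl b.1) Gg gt rtq qs.
by rewrite (pcat_plength0 qs s0); apply: pldiv_refl.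
Qed.

Lemma next_f_ex x : Oset le G (tpg x.1).2 x.2 -> exists y, next_f_spec le G (S := S) x y.
Proof.
case: x => i q /= [[[p pq] _ _] [g [q' [[Gg [t gt tq]] _]]]].
have [|a [b abE]] := I_span (w := cinj f (tpg i).1
    ((ccoef (sg i) (tpg i) / pcoef g t) *: (pbase k q' * g))).
  by apply: cinj_coprodI; apply: idealZ; apply: idealMl; apply: G_I.
(* With the [g]-multiple written as [csum a + csum b], the decomposition asked for has
   [yl = cinj sg i p - a] and [yl' = - b]; the new element is therefore [a] itself. *)
exists (cinj sg i (pbase k p) - (cinj sg i (pbase k p) - a)).
exists (tpg i), p, g, q', t, (cinj sg i (pbase k p) - a), (- b); split=> //=.
  exact: (tipped_tip sg_tipped).
by rewrite abE raddfB raddfN /= csum_cinj opprD addrA.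
Qed.

(** In [D = f^n_i p - X] the common tip cancels, so every term of [yl] has a strictly smaller tip
    and [y] keeps the tip of its first summand. Moreover [csum y = X + csum yl'], and both summands
    lie in the coproduct of the [f_i I]. *)
Lemma next_f_prop x y : next_f_spec le G (S := S) x y ->
  exists p, [/\ pcat (tpg x.1).2 p = Some x.2,
    is_ctip (next_ord (S := S)) y (x.1, p), y = y ** e (terminus x.2)
    & csum y \in coprodI_pred f I].
Proof.
case: x => i q [b [p [g [q' [t [yl [yl' /=]]]]]]] [ib bpq [Gg gt q't] DE ->].
have {ib} bE : b = tpg i := ctip_uniq f_free ord_good ib (tipped_tip sg_tipped i).
rewrite {b}bE in bpq DE *; have it := tipped_tip sg_tipped i.
have iv := ctip_valid f_free it; have [_ qo _ _] := pcat_inv bpq.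
have [c0 _] := it; have [g0 _] := gt.
set c := (ccoef (sg i) (tpg i) / pcoef g t) in DE.
have cn0 : c != 0 by rewrite mulf_neq0 ?invr_neq0.
set D := (_ - _) in DE; set X := cinj f _ _ in D DE.
have pt : is_ctip ord (sg i ** pbase k p) ((tpg i).1, q) by apply: (ctip_ract f_free ord_good).
have oq : origin q = v (tpg i).1 by rewrite qo.
have [_ q'o _ _] := pcat_inv q't.
have Xt : is_ctip ord X ((tpg i).1, q).
  apply: (ctip_cinj f_free ord_good); last by apply: tipZ => //; apply: tip_mull gt q't.
  by rewrite palg_scaleAr mulrA vertl_base -oq q'o eqxx.
have D0 : ccoef D ((tpg i).1, q) = 0.
  rewrite (ccoefB f_free) (ccoef_ract_cat f_free _ _ bpq) (ccoef_cinj f_free) /= eqxx.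
  rewrite palg_scaleAr pcoefZ pcoef_vertl -oq eqxx (pcoef_mull_cat _ q't).
  by rewrite /c divfK // -surjective_pairing subrr.
have Dm d : ccoef D d != 0 -> ord d ((tpg i).1, q).
  rewrite (ccoefB f_free); have [->|/(proj2 pt)//] := eqVneq (ccoef (sg i ** pbase k p) d) 0.
  by rewrite sub0r oppr_eq0 => /(proj2 Xt).
have qv : valid v ((tpg i).1, q) by [].
have [z [zE zl]] := join_merge h_free yl yl'.
(* A term of [yl] has its tip below that of [D], which is at most [q] in this coordinate; equality
   is excluded because [D] has coefficient zero there. *)
have ylm d : ccoef yl d != 0 -> ord (tip_of tpg d) ((tpg i).1, q) /\
    tip_of tpg d <> ((tpg i).1, q).
  case: d => l p' yd; have zd : ccoef z (inl l, p') != 0 by rewrite zl.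
  have [|b0 [b0v _ b0t b0m]] := @csum_ctip _ _ _ _ _ _ _ f_free _ ord_good _ _ _ _ h_tipped z.
    by move=> z0; move: zd; rewrite z0 (ccoef0 h_free) eqxx.
  rewrite zE -DE in b0t; have [Db0 _] := b0t.
  have b0q := Dm _ Db0; have lb0 := b0m _ zd.
  have b0v' := ctip_valid f_free b0t.
  have lv : valid v (tip_of tpg (l, p')).
    apply: (tip_of_valid f_free ord_good sg_tipped).
    exact: (ccoef_valid sg_free yd).
  split; first exact: (go_trans ord_good) lb0 b0q.
  move=> lq; move: Db0; have <- : ((tpg i).1, q) = tip_of tp b0.
    by apply: (go_anti ord_good) => //; rewrite -lq.
  by rewrite D0 eqxx.
have pv : valid vg (i, p) := valid_cat f_free h_tipped (j := inl i) bpq.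
have tpq : tip_of tpg (i, p) = ((tpg i).1, q) := tip_of_cat (tp := tpg) bpq.
exists p; split=> //.
- split.
    rewrite (ccoefB sg_free) (ccoef_cinj sg_free) /= eqxx vertl_base pv eqxx pcoef_base eqxx.
    have [->|/ylm[_]] := eqVneq (ccoef yl (i, p)) 0; first by rewrite subr0 oner_neq0.
    by rewrite tpq.
  move=> d; rewrite (ccoefB sg_free).
  have [->|yd _] := eqVneq (ccoef yl d) 0; last first.
    apply/(tip_ordE f_free ord_good sg_tipped) => //.
      exact: (ccoef_valid sg_free yd).
    by rewrite tpq; have [] := ylm _ yd.
  rewrite subr0 (ccoef_cinj sg_free); case: d => j p'.
  case: (i =P j) => [<-|]; last by rewrite eqxx.
  rewrite vertl_base pv eqxx pcoef_base; case: (p =P p') => [<- _|]; last by rewrite eqxx.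
  by have [] := go_total next_ord_good pv pv.
- have qt : terminus q = terminus p by have [_ _ _] := pcat_inv bpq.
  have qt' : terminus q = terminus t by have [_ _ _] := pcat_inv q't.
  have De : D ** e (terminus q) = D.
    rewrite /D /X ractBl ractA vertr_base qt eqxx; congr (_ - _).
    by rewrite cinj_ract palg_scaleAl -mulrA -qt qt' (uniform_terminus (G_unif Gg) gt).
  (* Since [D] is fixed by this vertex, so is its [yl]-part, the sum of the two coproducts being
     direct. *)
  have yle : yl ** e (terminus q) = yl.
    apply: subr0_eq; apply: (@join_inj _ (yl' ** e (terminus q) - yl')).
    rewrite !raddfB /= !linear_ract addrACA -opprD -ractDl -DE De.
    exact: subrr.
  by rewrite ractBl yle cinj_ract vertr_base qt eqxx.
- have -> : csum (cinj sg i (pbase k p) - yl) = X + csum yl'.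
    rewrite raddfB /= csum_cinj; apply/eqP; rewrite subr_eq -addrA [csum yl' + _]addrC -DE.
    by rewrite /D addrC subrK.
  apply: rpredD; last exact: csum_coprodI.
  by apply: cinj_coprodI; apply: idealZ; apply: idealMl; apply: G_I.
Qed.

(** Not being in [O], the path [q] has [q'] at least as long as the tip path of [f^n_i]. Both are
    prefixes of [q], so [z] is the cofactor. *)
Lemma next_f'_ex x : Nset le G (tpg x.1).2 x.2 -> exists y, next_f'_spec le G (S := S) x y.
Proof.
case: x => i q /= [[pq [g [t [Gg gt [q' tq]]]] qmin] notO].
have pq' : (plength (tpg i).2 <= plength q')%N.
  rewrite leqNgt; apply/negP => lt; apply: notO; split.
    by split=> //; exists g, t; split=> //; exists q'.
  by exists g, q'; split=> //; split=> //; exists t.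
have [|z zE] := pldiv_total pq _ pq'; first by exists t.
exists (cinj sg i (pbase k z * g)), (tpg i), z, g, q', t; split=> //.
exact: (tipped_tip sg_tipped).
Qed.

Lemma next_f'_prop x y : next_f'_spec le G (S := S) x y ->
  exists p, [/\ pcat (tpg x.1).2 p = Some x.2,
    is_ctip (next_ord (S := S)) y (x.1, p), y = y ** e (terminus x.2)
    & y \in coprodI_pred sg I].
Proof.
case: x => i q [b [z [g [q' [t /=]]]]] [ib [Gg gt q't] bz ->].
have {ib} bE : b = tpg i := ctip_uniq f_free ord_good ib (tipped_tip sg_tipped i).
rewrite {b}bE in bz; have [p ztp pq] := pcat_assoc bz q't.
have pv : valid vg (i, p) := valid_cat f_free h_tipped (j := inl i) pq.
have [_ zo _ _] := pcat_inv ztp; have [_ _ _ qt] := pcat_inv q't.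
exists p; split=> //.
- apply: (ctip_cinj sg_free next_ord_good); last exact: tip_mull gt ztp.
  by rewrite mulrA vertl_base -zo pv eqxx.
- by rewrite cinj_ract -mulrA qt (uniform_terminus (G_unif Gg) gt).
- apply/(coprodIP sg_free) => j; rewrite (ccr_cinj sg_free).
  by case: eqP => _; rewrite ?rpred0 // idealMl // idealMl // G_I.
Qed.

Local Notation S' := (next_stage le G S).

Definition next_index (j : (sT' S' + sU' S')%type) : T' * qpath Q :=
  match j with inl x => val x | inr x => val x end.

Lemma next_T_index (x : sT' S') : Oset le G (tpg (val x).1).2 (val x).2.
Proof.
case: x => -[i q] /= /asboolP[b /= ib].
by rewrite (ctip_uniq f_free ord_good ib (tipped_tip sg_tipped i)).
Qed.

Lemma next_U_index (x : sU' S') : Nset le G (tpg (val x).1).2 (val x).2.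
Proof.
case: x => -[i q] /= /asboolP[b /= ib].
by rewrite (ctip_uniq f_free ord_good ib (tipped_tip sg_tipped i)).
Qed.

Lemma next_f_spec_sg (x : sT' S') : next_f_spec le G (S := S) (val x) (Defs.sg x).
Proof. exact: xgetPex (next_f_ex (next_T_index x)). Qed.

Lemma next_f'_spec_sg' (x : sU' S') : next_f'_spec le G (S := S) (val x) (Defs.sg' x).
Proof. exact: xgetPex (next_f'_ex (next_U_index x)). Qed.

Local Notation h' := (joinf (@Defs.sg _ _ S') (@Defs.sg' _ _ S')).

Definition next_v (j : (sT' S' + sU' S')%type) : vertex Q := terminus (next_index j).2.

(** The path here is the cofactor of [q] by the tip path of the old generator; it exists because [q]
    lies in [X], so the default value is never taken. *)
Definition next_tip (j : (sT' S' + sU' S')%type) : T' * qpath Q :=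
  ((next_index j).1, xget (next_index j).2
    [set p | pcat (tpg (next_index j).1).2 p = Some (next_index j).2]%classic).

Lemma next_tipE j p : pcat (tpg (next_index j).1).2 p = Some (next_index j).2 ->
  next_tip j = ((next_index j).1, p).
Proof.
by move=> pE; congr (_, _); apply: xget_unique => // p' p'E; apply: pcat_injl p'E pE.
Qed.

Lemma next_X j : Xset le G (tpg (next_index j).1).2 (next_index j).2.
Proof. by case: j => x; [case: (next_T_index x) | case: (next_U_index x)]. Qed.

Lemma next_tip_cat j :
  pcat (tpg (next_index j).1).2 (next_tip j).2 = Some (next_index j).2.
Proof. by have [[p pE] _ _] := next_X j; rewrite (next_tipE pE). Qed.

(** Only the mixed cases need an argument: [O] and [N] are disjoint. *)
Lemma next_index_inj : injective next_index.
Proof.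
move=> [x|x] [y|y] /= xy.
- by congr inl; apply: val_inj.
- have [_ nO] := next_U_index y; have := next_T_index x.
  by rewrite (xy : val x = val y).
- have [_ nO] := next_U_index x; have := next_T_index y.
  by rewrite -(xy : val x = val y).
- by congr inr; apply: val_inj.
Qed.

Lemma next_tipped : tipped (next_ord (S := S)) h' next_v next_tip.
Proof.
split.
- move=> [x|x] /=.
    have [p [pE xt _ _]] := next_f_prop (next_f_spec_sg x).
    by rewrite (@next_tipE (inl x) p).
  have [p [pE xt _ _]] := next_f'_prop (next_f'_spec_sg' x).
  by rewrite (@next_tipE (inr x) p).
- move=> [x|x] /=; first by have [p []] := next_f_prop (next_f_spec_sg x).
  by have [p []] := next_f'_prop (next_f'_spec_sg' x).
(* Division of tips becomes division of the paths [q]. The smaller one ends in a tip of [G], so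
   condition (3) for the larger leaves only a vertex as cofactor. *)
- move=> j j' jj' [s sE]; apply: next_index_inj.
  have jE := next_tip_cat j; have j'E := next_tip_cat j'.
  have j1 : (next_index j).1 = (next_index j').1 by [].
  rewrite -j1 in j'E; have [u uE us] := pcat_assocV sE j'E.
  rewrite jE in uE; case: uE => uE; rewrite -{u}uE in us.
  have [_ [g [t [Gg gt [r rt]]]] _] := next_X j.
  have [_ _ jmin] := next_X j'.
  have s0 := jmin _ _ _ _ _ Gg gt rt us.
  by rewrite [LHS]surjective_pairing [RHS]surjective_pairing j1 (pcat_plength0 us s0).
Qed.

(** This is the intersection formula of the construction. The new generators lie in the left side by
    their construction; conversely [span_reduce] applies, with tips supplied by [syzygy_tip]. *)
Lemma next_exact (w : coprod sg) : csum w \in coprodI_pred f I <->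
  exists (a : coprod (@Defs.sg _ _ S')) (b : coprod (@Defs.sg' _ _ S')), w = csum a + csum b.
Proof.
have spanI (z : coprod h') : csum (csum z) \in coprodI_pred f I.
  have [a [b ->]] := join_split (tipped_free sg_free next_ord_good next_tipped) z.
  rewrite raddfD /= rpredD //; last first.
    apply: csumI; apply: csum_coprodI => x.
    by have [p []] := next_f'_prop (next_f'_spec_sg' x).
  rewrite [csum a]/csum raddf_sum /=; apply: rpred_sum => x _.
  have [r ->] := ccompP a x; rewrite linear_ract; apply: coprodI_ract.
  by have [p []] := next_f_prop (next_f_spec_sg x).
split=> [wI|[a [b ->]]]; last first.
  have [z [<- _]] := join_merge (tipped_free sg_free next_ord_good next_tipped) a b.
  exact: spanI.
have [|||z <-] := @span_reduce _ _ _ _ _ _ _ sg_free _ next_ord_good _ _ _ _ next_tipped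
  (fun w => csum w \in coprodI_pred f I) _ _ _ w wI.
- by move=> x y xI yI; rewrite raddfB /= rpredB.
- exact: spanI.
- move=> x c xI xc; have [q [m [Xq cm [s qs]]]] := syzygy_tip xI xc.
  (* The path [q] lies in [O] or in [N], and accordingly names a generator of the first or second
     kind. *)
  have [j jE] : exists j, next_index j = (c.1, q).
    have ct := tipped_tip sg_tipped c.1.
    have [O|nO] := pselect (Oset le G (tpg c.1).2 q).
      have xP : `[< exists2 b, is_ctip ord (sg (c.1, q).1) b & Oset le G b.2 (c.1, q).2 >].
        by apply/asboolP; exists (tpg c.1).
      by exists (inl (exist _ (c.1, q) xP)).
    have xP : `[< exists2 b, is_ctip ord (sg (c.1, q).1) b & Nset le G b.2 (c.1, q).2 >].
      by apply/asboolP; exists (tpg c.1).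
    by exists (inr (exist _ (c.1, q) xP)).
  have jc : pcat (tpg c.1).2 (next_tip j).2 = Some q.
    by have := next_tip_cat j; rewrite jE.
  have [d dE dm] := pcat_assoc jc qs.
  have cd : c.2 = d := pcat_injl cm dm; rewrite -{d dm}cd in dE.
  exists (j, s); first exact: (valid_cat sg_free next_tipped dE).
  by rewrite (tip_of_cat dE) [RHS]surjective_pairing /= jE.
exact: (join_split (tipped_free sg_free next_ord_good next_tipped)).
Qed.
End Step.

(** * Modules over the quotient *)

Definition finitely_indexed (T : eqType) := exists s : seq T, forall x, x \in s.

Section QuotientModules.
Variables (A : pzRingType) (I : ideal A) (N : lmodType A^c) (T : choiceType) (f : T -> N).

Lemma cpi0 : cpi I (0 : coprod f) = 0.
Proof. exact: (raddf0 (\pi_(Quotient.quot (coprodI_pred f I)))%qT). Qed.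

Lemma cpi_sum (J : Type) (s : seq J) (F : J -> coprod f) :
  cpi I (\sum_(j <- s) F j) = \sum_(j <- s) cpi I (F j).
Proof. by apply: (big_morph (cpi I)) => [x y|]; [apply: cpiD | apply: cpi0]. Qed.

Lemma cpi_eq0 (w : coprod f) : cpi I w = 0 <-> w \in coprodI_pred f I.
Proof.
rewrite -cpi0; split=> [/cpiP|wI]; first by rewrite subr0.
by apply/cpiP; rewrite subr0.
Qed.

Lemma coprod_sum_cinj (s : seq T) (w : coprod f) (r : T -> A) : uniq s ->
  (forall i, ccomp w i = f i ** r i) -> (forall i, ccomp w i != 0 -> i \in s) ->
  w = \sum_(i <- s) cinj f i (r i).
Proof.
move=> s_uniq wr ws; apply: coprodP => j; rewrite ccomp_sum.
under eq_bigr => i _ do rewrite ccomp_cinj.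
rewrite -big_mkcond /=; have [js|js] := boolP (j \in s).
  by rewrite -big_filter filter_pred1_uniq // big_seq1.
rewrite big1_seq => [|i /andP[/eqP -> i_s]]; last by rewrite i_s in js.
by apply/eqP; apply: contraNT js => /ws.
Qed.

Lemma coprod_mod_fin_gen : finitely_indexed T -> fin_gen (coprod_mod f I).
Proof.
move=> [s sT]; pose s' := undup s.
exists (size s'), (fun l => cpi I (cinj f (tnth (in_tuple s') l) 1)) => x.
pose r i := sval (cid (ccompP (crepr x) i)).
exists (fun l => qpi I (r (tnth (in_tuple s') l)) : (quotring I)^c).
rewrite -{1}[x]creprK {1}(@coprod_sum_cinj s' (crepr x) r) ?undup_uniq //; last first.
- by move=> i _; rewrite mem_undup.
- by move=> i; rewrite /r; case: cid.
rewrite cpi_sum (big_tnth _ _ s'); apply: eq_bigr => l _.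
by rewrite -[RHS](cpiZ I) cinj_ract mul1r.
Qed.
End QuotientModules.

Section ExactnessModI.
Variables (A : pzRingType) (I : ideal A) (N : lmodType A^c) (T : choiceType) (f : T -> N).
Variables (T1 : choiceType) (g : T1 -> coprod f).

Lemma cdiff_exact (T2 : choiceType) (g2 : T2 -> coprod g) :
  (forall w : coprod g, csum w \in coprodI_pred f I <->
    exists a : coprod g2, w - csum a \in coprodI_pred g I) ->
  forall x, cdiff (I := I) (g := g) x = 0 <-> exists y, cdiff (I := I) (g := g2) y = x.
Proof.
move=> g_exact x; rewrite -[x]creprK cdiffE.
apply: iff_trans (cpi_eq0 _ _) (iff_trans (g_exact _) _).
split=> [[a wa]|[y]]; first by exists (cpi I a); rewrite cdiffE; apply/esym/cpiP.
by rewrite -[y]creprK cdiffE => /esym/cpiP wy; exists (crepr y).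
Qed.

(** The second family vanishes modulo [I], so the first alone generates the kernel of the induced
    map. *)
Lemma caug_exact (T2 : choiceType) (g2 : T2 -> coprod f) (M : lmodType (quotring I)^c)
    (pi : {linear coprod f -> restr M}) :
  (forall j, g2 j \in coprodI_pred f I) ->
  (forall z, pi z = 0 <-> exists (a : coprod g) (b : coprod g2), z = csum a + csum b) ->
  forall x, caug pi x = 0 <-> exists y, cdiff (I := I) (g := g) y = x.
Proof.
move=> g2_I pi_exact x; rewrite -[x]creprK caugE; split=> [/pi_exact[a [b ->]]|[y]].
  exists (cpi I a); rewrite cdiffE; apply/cpiP.
  by rewrite opprD addrA subrr add0r rpredN csum_coprodI.
rewrite -[y]creprK cdiffE => yx; rewrite -(caugE pi) -yx caugE.
by apply/pi_exact; exists (crepr y), 0; rewrite raddf0 addr0.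
Qed.
End ExactnessModI.

Lemma ract_qpi_affine (A : pzRingType) (I : ideal A) (U : lmodType (quotring I)^c)
    (u : U) (a r b : A) :
  u ** qpi I (a * r + b) = u ** qpi I a ** qpi I r + u ** qpi I b.
Proof. by rewrite qpiD ractDr -qpiM -ractA. Qed.

(** * Projectivity of the modules of the resolution *)

Section Projectivity.
Variables (k : fieldType) (Q : quiver).
Local Notation R := (palg k Q).
Local Notation e v := (pbase k (vpath v)).
Variables (I : ideal R) (N : lmodType R^c) (T : choiceType) (f : T -> N) (v : T -> vertex Q).
Hypothesis f_free : free_family f v.

Section Lift.
Variables (U : lmodType (quotring I)^c) (u : T -> U).

(** The map carrying the [i]-th generator to [u i] times the vertex [v i]. As [ccr] already lies in
    [v_i R], the element [u i] may be an arbitrary preimage. *)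
Definition lift_sum (w : coprod f) : U :=
  \sum_(i <- msupp (cval w : {malg N[T]})) u i ** qpi I (ccr w i).

Lemma ccr_out (w : coprod f) i : i \notin msupp (cval w : {malg N[T]}) -> ccr w i = 0.
Proof.
move=> /mcoeff_outdom wi; rewrite -(ccr_v f_free).
by rewrite -(mulr0 (e (v i))); apply: (free_inj f_free); rewrite -(ccompE f_free) ract0r.
Qed.

Lemma qpi0 : qpi I 0 = 0.
Proof. exact: (raddf0 (\pi_(Quotient.quot (I : zmodClosed R)))%qT). Qed.

Lemma lift_sumw (d : {fset T}) w : (msupp (cval w : {malg N[T]}) `<=` d)%fset ->
  lift_sum w = \sum_(i <- d) u i ** qpi I (ccr w i).
Proof.
move=> wd; rewrite /lift_sum (big_fset_incl _ wd) // => i _.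
by move/ccr_out ->; rewrite qpi0 ract0r.
Qed.

Lemma lift_sumD w w' r : lift_sum (w ** r + w') = lift_sum w ** qpi I r + lift_sum w'.
Proof.
pose x : coprod f := w ** r + w'; pose d := (msupp (cval x : {malg N[T]}) `|`
  (msupp (cval w : {malg N[T]}) `|` msupp (cval w' : {malg N[T]})))%fset.
rewrite -/x (@lift_sumw d x) ?fsubsetUl //.
rewrite (@lift_sumw d w); last by rewrite /d fsetUCA fsubsetUl.
rewrite (@lift_sumw d w'); last by rewrite /d fsetUA fsubsetUr.
rewrite ract_suml -big_split; apply: eq_bigr => i _ /=.
have -> : ccr x i = ccr w i * r + ccr w' i by rewrite (ccrD f_free) (ccr_ract f_free).
exact: ract_qpi_affine.
Qed.

Lemma lift_sumI w : w \in coprodI_pred f I -> lift_sum w = 0.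
Proof.
move=> /(coprodIP f_free) wI; rewrite /lift_sum big1 // => i _.
have -> : qpi I (ccr w i) = 0 by rewrite -qpi0; apply/qpiP; rewrite subr0.
exact: ract0r.
Qed.

Definition lift (x : coprod_mod f I) : U := lift_sum (crepr x).

Lemma liftE w : lift (cpi I w) = lift_sum w.
Proof.
have /cpiP : cpi I (crepr (cpi I w)) = cpi I w by rewrite creprK.
move=> /lift_sumI d0; have := lift_sumD (crepr (cpi I w) - w) w 1.
by rewrite ract1 d0 ract0l add0r subrK.
Qed.

Lemma lift_linear : linear lift.
Proof.
move=> a x y; rewrite -[x]creprK -[y]creprK -[a](@qreprK R I).
rewrite -[_ *: cpi I _](cpiZ I (qrepr a)) -cpiD !liftE lift_sumD.
by [].
Qed.

HB.instance Definition _ := GRing.isLinear.Build (quotring I)^c (coprod_mod f I) U _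
  lift lift_linear.
End Lift.

Lemma coprod_mod_projective : projective (coprod_mod f I).
Proof.
move=> U V g h g_surj.
pose u i : U := sval (cid (g_surj (h (cpi I (cinj f i 1))))).
have uE i : g (u i) = h (cpi I (cinj f i 1)) by rewrite /u; case: cid.
exists (lift u : {linear coprod_mod f I -> U}) => x /=.
rewrite -[x]creprK liftE /lift_sum; set w := crepr x.
rewrite raddf_sum /= [in RHS](@coprod_sum_cinj _ _ _ _ (msupp (cval w : {malg N[T]})) w (ccr w)).
- rewrite cpi_sum raddf_sum /=; apply: eq_bigr => i _.
  rewrite linear_ract uE -linear_ract; congr (h _).
  by rewrite -cpiZ cinj_ract mul1r.
- exact: fset_uniq.
- by move=> i; apply: (ccompE f_free).
- by move=> i wi; rewrite -mcoeff_neq0.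
Qed.
End Projectivity.

(** * The initial presentation *)

Section BaseOrder.
Variables (Q : quiver) (le : rel (qpath Q)).
Hypothesis le_adm : admissible_order le.
Variables (T : eqType) (leT : rel T) (v : T -> vertex Q).
Hypothesis leT_wo : well_order leT.
Let le_wo := admissible_wo le_adm.

Lemma base_ord_good : good_order le v (base_ord le leT).
Proof.
rewrite /base_ord; split.
- move=> [i p] [j q] _ _ /=; rewrite [q == p]eq_sym.
  by case: eqP => _; apply/orP; apply: wo_total.
- move=> [i p] [j q] _ _ /=; rewrite [q == p]eq_sym; case: eqP => [->|pq] ij ji.
    by rewrite (wo_anti leT_wo ij ji).
  by case: pq; apply: (wo_anti le_wo).
- move=> [j q] [i p] [l r] _ _ _ /=.
  case: (p =P q) => [->|pq]; case: (q =P r) => [qr|qr] //.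
  + exact: wo_trans.
  + by rewrite -qr (introF eqP pq).
  + move=> p_q q_r; case: (p =P r) => [pr|_]; last exact: (wo_trans le_wo) p_q q_r.
    by case: pq; rewrite -pr in q_r; apply: (wo_anti le_wo).
- move=> A _ [[i p] Aip].
  (* Paths are compared first: take the least path in [A], then the least index that occurs with
     it. *)
  have [|q [j Ajq] qmin] := wo_min le_wo (A := [set q | exists j, A (j, q)]%classic).
    by exists p, i.
  have [|l Alq lmin] := wo_min leT_wo (A := [set l | A (l, q)]%classic).
    by exists j.
  exists (l, q) => // -[l' q'] Al'q' /=; case: eqP => [qq'|_]; last by apply: qmin; exists l'.
  by apply: lmin; rewrite /= qq'.
- move=> i p q _ _ /=; case: eqP => [->|//]; by rewrite !wo_refl.
- move=> i j p q s ps qs _ _ psE qsE /=.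
  case: (p =P q) => [pq|pq].
    by move: qsE; rewrite -pq psE => -[->]; rewrite eqxx.
  have -> : (ps == qs) = false.
    by apply/eqP => ps_qs; apply: pq; rewrite -ps_qs in qsE; apply: pcat_injr psE qsE.
  exact: adm_r qsE psE.
Qed.
End BaseOrder.

(** * Vertex generators and the minimal tips of the kernel *)

Section Presentation.
Variables (k : fieldType) (Q : quiver) (le : rel (qpath Q)).
Hypothesis le_adm : admissible_order le.
Local Notation R := (palg k Q).
Local Notation e v := (pbase k (vpath v)).
Variables (n : nat).

Let T0 : choiceType := ('I_n * vertex Q)%type.

(** The free module [R^n] splits into copies of the [v R], whose generators are right uniform.
    [vert_row] is the isomorphism back to rows. *)
Definition vert_family (b : T0) : (R^c)^o := e b.2.

Lemma vert_family_free : free_family vert_family snd.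
Proof. by move=> b; split=> [|r //]; rewrite -[RHS]/(e b.2 * e b.2) vertM. Qed.

Definition vert_row (w : coprod vert_family) : 'rV[R^c]_n :=
  \row_a \sum_(u : vertex Q) (ccomp w (a, u) : R^c).

Lemma vert_row_linear : linear vert_row.
Proof.
move=> r x y; apply/rowP => a; rewrite !mxE mulr_sumr -big_split.
by apply: eq_bigr => u _; rewrite ccompD ccompZ.
Qed.

HB.instance Definition _ := GRing.isLinear.Build R^c (coprod vert_family) 'rV[R^c]_n _
  vert_row vert_row_linear.

Lemma vert_row_inj w : vert_row w = 0 -> w = 0.
Proof.
move=> w0; apply: coprodP => -[a u]; rewrite ccomp0.
(* Left multiplication by [e u] isolates the component at [u] from the sum forming a row entry. *)
have compE u' : e u * (ccomp w (a, u') : R) = if u' == u then ccomp w (a, u) : R else 0.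
  have [r rE] := ccompP w (a, u'); case: (u' =P u) => [<-|u'u].
    by rewrite rE -[_ ** r]/(e u' * r) mulrA vertM.
  by rewrite rE -[_ ** r]/(e u' * r) mulrA vert_neq ?mul0r // eq_sym; apply/eqP.
have := congr1 (fun x : 'rV[R^c]_n => e u * (x 0 a : R)) w0.
rewrite !mxE mulr0 => <-.
rewrite -[X in _ = e u * X]/(\sum_(u' : vertex Q) (ccomp w (a, u') : R)).
by rewrite mulr_sumr (eq_bigr _ (fun u' _ => compE u')) -big_mkcond big_pred1_eq.
Qed.

Lemma vert_row_surj x : exists w, vert_row w = x.
Proof.
exists (\sum_(b : T0) cinj vert_family b (x 0 b.1 : R)); apply/rowP => a.
rewrite mxE; transitivity (\sum_(u : vertex Q) (e u * (x 0 a : R)) : R^c).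
  apply: eq_bigr => u _; rewrite ccomp_sum (bigD1 (a, u)) //= big1 ?addr0.
    by rewrite ccomp_cinj eqxx.
  by move=> b bu; rewrite ccomp_cinj (negPf bu).
by rewrite -[LHS]/(\sum_(u : vertex Q) (e u * (x 0 a : R)) : R) -mulr_suml sum_vert mul1r.
Qed.

Variables (m : nat) (K : set (coprod vert_family)) (W : 'I_m -> coprod vert_family).
Hypothesis K_gen : forall w, K w <-> exists y : 'I_m -> R, w = \sum_l W l ** y l.
Variable leT : rel T0.
Hypothesis leT_wo : well_order leT.

Local Notation ord := (base_ord le leT).
Let ord_good : good_order le snd ord := base_ord_good le_adm snd leT_wo.
Let f_free := vert_family_free.

Let K_sub x y : K x -> K y -> K (x - y).
Proof.
move=> /K_gen[a ->] /K_gen[b ->]; apply/K_gen; exists (fun l => a l - b l).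
by rewrite -sumrB; apply: eq_bigr => l _; rewrite ractBr.
Qed.

Let K_ract x r : K x -> K (x ** r).
Proof.
move=> /K_gen[a ->]; apply/K_gen; exists (fun l => a l * r).
by rewrite ract_suml; apply: eq_bigr => l _; rewrite ractA.
Qed.

Let K0 : K 0.
Proof. by apply/K_gen; exists (fun=> 0); rewrite big1 // => l _; rewrite ract0r. Qed.

Definition kernel_tip (b : T0 * qpath Q) := exists2 w, K w & is_ctip ord w b.

(** Minimality is with respect to left division, so that no two of these tips left divide each
    other. *)
Definition minimal_tip (b : T0 * qpath Q) := kernel_tip b /\
  forall b', kernel_tip b' -> b'.1 = b.1 -> pldiv b'.2 b.2 -> b' = b.

Definition min_tips : choiceType := {b : T0 * qpath Q | `[< minimal_tip b >]}.

Lemma min_tip_ex (j : min_tips) : exists w, [/\ K w, is_ctip ord w (val j)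
  & w = w ** e (terminus (val j).2)].
Proof.
case: j => -[i p] /= /asboolP[[w Kw wt] _]; exists (w ** e (terminus p)); split.
- exact: K_ract.
- by apply: (ctip_ract f_free ord_good wt); apply: pcat_vpathr.
- by rewrite ractA vertM.
Qed.

Definition min_gen (j : min_tips) : coprod vert_family := sval (cid (min_tip_ex j)).
(** The minimal tips already account for all of [K], so the family [f^1'] is empty. *)
Definition no_gen (j : void) : coprod vert_family := match j with end.

Lemma min_gen_tipped :
  tipped ord min_gen (fun j => terminus (val j).2) val.
Proof.
split=> [j|j|j j' j1 jj']; try by rewrite /min_gen; case: cid => w [].
case: j' j1 jj' => b' b'P j1 jj'; apply: val_inj => /=.
have /asboolP[_] := b'P; apply=> //.
by have /asboolP[] := valP j.
Qed.

Lemma min_gen_span w : K w <-> exists z : coprod min_gen, w = csum z.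
Proof.
have K_csum (z : coprod min_gen) : K (csum z).
  rewrite /csum; apply: (big_ind K) => //.
    by move=> x y Kx Ky; rewrite -[y]opprK -[- y]add0r; apply: K_sub => //; apply: K_sub.
  move=> j _; have [r ->] := ccompP z j; apply: K_ract.
  by rewrite /min_gen; case: cid => ? [].
split=> [Kw|[z ->//]].
have [|||z <-] := span_reduce f_free ord_good min_gen_tipped (K := K) _ _ _ Kw; last by exists z.
- exact: K_sub.
- exact: K_csum.
move=> {Kw}w [i p] Kw wt.
(* The shortest prefix of [p] that is still a tip of [K] in coordinate [i] is a minimal tip. *)
pose P l := `[< exists q, [/\ plength q = l, pldiv q p & kernel_tip (i, q)] >].
have exP : exists l, P l.
  by exists (plength p); apply/asboolP; exists p; split=> //; [exact: pldiv_refl | exists w].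
case: (ex_minnP exP) => l /asboolP[q [ql [s qs] qt]] lmin.
have qP : `[< minimal_tip (i, q) >].
  apply/asboolP; split=> // -[i' q'] q't /= i'i q'q; congr (_, _) => //.
  apply: pldiv_anti => //; rewrite ql; apply: lmin; apply/asboolP.
  exists q'; split=> //; last by rewrite -i'i.
  by apply: pldiv_trans q'q _; exists s.
pose j : min_tips := exist _ (i, q) qP.
have jE : pcat (val j).2 s = Some p by [].
exists (j, s); first exact: (valid_cat f_free min_gen_tipped jE).
by rewrite (tip_of_cat jE).
Qed.

(** The finitely many [W l] involve finitely many of the [min_gen]. Each [min_gen j] is a
    combination of the [W l], and by directness its own index must occur in one of them. *)
Lemma min_tips_finite : finitely_indexed min_tips.
Proof.
have Kz l : exists z : coprod min_gen, W l = csum z.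
  apply/min_gen_span/K_gen; exists (fun l' => if l' == l then 1 else 0).
  rewrite (bigD1 l) //= eqxx ract1 big1 ?addr0 // => l' l'l.
  by rewrite (negPf l'l) ract0r.
pose z l := sval (cid (Kz l)).
have zE l : W l = csum (z l) by rewrite /z; case: cid.
have h_free := tipped_free f_free ord_good min_gen_tipped.
exists (flatten [seq map fst (csupp (z l)) | l <- enum 'I_m]) => j.
have [y yE] : exists y : 'I_m -> R, min_gen j = \sum_l W l ** y l.
  by apply/K_gen/min_gen_span; exists (cinj min_gen j 1); rewrite csum_cinj ract1.
have cE : cinj min_gen j 1 = \sum_l z l ** y l.
  apply: (csum_inj f_free ord_good min_gen_tipped).
  rewrite csum_cinj ract1 yE raddf_sum /=; apply: eq_bigr => l _.
  by rewrite zE linear_ract.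
apply: contraT => jz; have := congr1 (fun w => ccoef w (j, vpath (terminus (val j).2))) cE.
rewrite (ccoef_cinj h_free) /= eqxx mulr1 pcoef_base eqxx (ccoef_sum h_free) big1.
  by move/eqP; rewrite oner_eq0.
move=> l _; have zj0 : ccr (z l) j = 0.
  apply: palgP => p; rewrite pcoef0; apply/eqP; apply: contraNT jz => zjp.
  apply/flattenP; exists (map fst (csupp (z l))); first by apply: map_f; rewrite mem_enum.
  by apply/mapP; exists (j, p) => //; rewrite (csuppP h_free).
by rewrite ccoefE (ccr_ract h_free) zj0 mul0r pcoef0.
Qed.
End Presentation.

(** * The associated resolution *)

Section Stages.
Variables (k : fieldType) (Q : quiver) (le : rel (qpath Q)).
Hypothesis le_adm : admissible_order le.
Local Notation R := (palg k Q).
Local Notation e v := (pbase k (vpath v)).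
Variable I : ideal R.

(** The induction invariant. Its fourth clause, that the two families span the coproduct of the
    [f_i I], is what makes the next family exist and be tip-reduced. *)
Definition stage_ok (S : stage k Q) : Prop := exists v vh tp,
  [/\ free_family (@Defs.sf _ _ S) v, good_order le v (@Defs.sord _ _ S),
      tipped (@Defs.sord _ _ S) (joinf (@Defs.sg _ _ S) (@Defs.sg' _ _ S)) vh tp,
      forall w, w \in coprodI_pred (@Defs.sf _ _ S) I ->
        exists (a : coprod (@Defs.sg _ _ S)) (b : coprod (@Defs.sg' _ _ S)),
          w = csum a + csum b
    & forall j, @Defs.sg' _ _ S j \in coprodI_pred (@Defs.sf _ _ S) I].

Lemma stage_ok_free S : stage_ok S -> exists v, free_family (@Defs.sf _ _ S) v.
Proof. by move=> [v [vh [tp []]]]; exists v. Qed.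

Section Next.
Variable G : set R.
Hypothesis G_basis : groebner_basis le I G.
Hypothesis G_unif : forall g, G g -> uniform g.

Lemma stage_ok_next S : stage_ok S -> stage_ok (next_stage le G S).
Proof.
case: S => N T f ord T' U' sg sg' [v [vh [tp /= [f_free ord_good h_tipped I_span sg'_I]]]].
have sg_free := join_freel (tipped_free f_free ord_good h_tipped).
exists (vh \o inl), (@next_v _ _ le G _ _ f ord _ _ sg sg'),
  (@next_tip _ _ le G _ _ f ord _ _ sg sg' tp); split.
- exact: sg_free.
- exact: (next_ord_good le_adm f_free ord_good h_tipped).
- exact: (next_tipped le_adm G_basis G_unif f_free ord_good h_tipped I_span sg'_I).
- move=> w wI; apply/(next_exact le_adm G_basis G_unif f_free ord_good h_tipped I_span sg'_I).
  exact: csumI.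
- move=> x.
  have xS := next_f'_spec_sg' f_free ord_good h_tipped x.
  by have [p []] := next_f'_prop le_adm G_basis G_unif f_free ord_good h_tipped xS.
Qed.

(** Modulo [I] the contribution of the [f^(n+1)'] disappears; conversely, the invariant of the next
    stage expresses any error term in both families. *)
Lemma stage_ok_exact S (w : coprod (@Defs.sg _ _ S)) : stage_ok S ->
  csum w \in coprodI_pred (@Defs.sf _ _ S) I <->
  exists a : coprod (@Defs.sg _ _ (next_stage le G S)),
    w - csum a \in coprodI_pred (@Defs.sg _ _ S) I.
Proof.
move=> S_ok; have S'_ok := stage_ok_next S_ok; move: S_ok S'_ok w.
case: S => N T f ord T' U' sg sg' [v [vh [tp /= [f_free ord_good h_tipped I_span sg'_I]]]].
move=> [_ [_ [_ [_ _ _ _ sg''_I]]]] w.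
apply: iff_trans (next_exact le_adm G_basis G_unif f_free ord_good h_tipped I_span sg'_I w) _.
split=> [[a [b ->]]|[a wa]].
  by exists a; rewrite addrAC subrr add0r; apply: csum_coprodI.
have [v' [vh' [tp' [_ _ _ I_span' _]]]] := stage_ok_next (S := Stage ord sg sg')
  (ex_intro _ v (ex_intro _ vh (ex_intro _ tp (And5 f_free ord_good h_tipped I_span sg'_I)))).
have [a' [b' E]] := I_span' _ wa.
by exists (a + a'), b'; rewrite raddfD /= -addrA -E addrC subrK.
Qed.

Hypothesis G_red : tip_reduced le G.
Hypothesis I_fin : exists G0 : set R, finite_set G0 /\ groebner_basis le I G0.

(** For [q] in [O(p)] the part before the end relation is shorter than [p], and the tips of [G] have
    length at most [n]. This bounds [q]. *)
Lemma next_T_finite S : stage_ok S -> finitely_indexed (sT' S) ->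
  finitely_indexed (sT' (next_stage le G S)).
Proof.
case: S => N T f ord T' U' sg sg' [v [vh [tp /= [f_free ord_good h_tipped I_span sg'_I]]]] [s sT].
have [n nP] := tip_reduced_bounded le_adm G_basis G_red I_fin.
pose paths m := sval (cid (finite_paths Q m)).
have pathsP m p : (plength p <= m)%N -> p \in paths m 
  by rewrite /paths; case: cid => t /=; apply.
exists (pmap insub [seq (i, q) | i <- s, q <- paths (plength (tp (inl i)).2 + n)%N]) => x.
rewrite mem_pmap_sub; apply/allpairsPdep; exists (val x).1, (val x).2; split.
- exact: sT.
- apply: pathsP; have [_ [g [q' [[Gg [t gt /pcat_plength ->]] q'p]]]] :=
    next_T_index f_free ord_good h_tipped x.
  by apply: leq_add; [apply: ltnW | apply: nP gt].
- by case: (val x).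
Qed.
End Next.

Section FirstStage.
Variable M : lmodType (quotring I)^c.

Lemma presentation_ex : fin_presented (restr M) -> exists P : admissible_presentation le M,
  [/\ stage_ok (first_stage P), finitely_indexed (pT0 P) & finitely_indexed (pT1 P)].
Proof.
move=> [m [n [rho [pi [pi_surj pi_exact]]]]].
pose f0 := @vert_family k Q n.
pose ppi : {linear coprod f0 -> restr M} := (pi \o @vert_row k Q n)%FUN.
have ppi_surj : surjective_map ppi.
  move=> y; have [x xy] := pi_surj y; have [w wx] := vert_row_surj x.
  by exists w; rewrite /ppi /= wx.
pose K : set (coprod f0) := [set w | ppi w = 0]%classic.
have WP l : exists w, vert_row w = rho (delta_mx 0 l) by apply: vert_row_surj.
(* Lifts of the images of the standard basis rows; they generate the kernel of [ppi]. *)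
pose W l : coprod f0 := sval (cid (WP l)).
have WE l : vert_row (W l) = rho (delta_mx 0 l) by rewrite /W; case: cid.
have K_gen w : K w <-> exists y : 'I_m -> R, w = \sum_l W l ** y l.
  split=> [Kw|[y ->]].
    have [y yw] := (pi_exact (vert_row w)).1 Kw.
    exists (fun l => y 0 l : R); apply/eqP; rewrite -subr_eq0; apply/eqP.
    have yE : rho y = \sum_l y 0 l *: rho (delta_mx 0 l).
      by rewrite {1}[y]row_sum_delta raddf_sum; apply: eq_bigr => l _; apply: linearZ.
    apply: vert_row_inj; rewrite raddfB raddf_sum /= -yw yE -sumrB big1 // => l _.
    apply/eqP; rewrite subr_eq0; apply/eqP; apply: etrans _ (esym (linear_ract _ _ _)).
    exact: (congr1 (fun u : 'rV[R^c]_n => y 0 l *: u) (esym (WE l))).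
  suff : ppi (\sum_l W l ** y l) = 0 by [].
  rewrite raddf_sum big1 // => l _.
  apply: etrans (linear_ract ppi _ _) _; have -> : ppi (W l) = 0.
    by apply/pi_exact; exists (delta_mx 0 l); apply: esym (WE l).
  exact: ract0l.
have [leT leT_wo] := well_ordering_principle ('I_n * vertex Q)%type.
pose f1 := @min_gen k Q le le_adm n m K W K_gen leT leT_wo.
pose f1' := @no_gen k Q n.
have f0_free := @vert_family_free k Q n.
have ord_good := base_ord_good le_adm (snd : _ -> vertex Q) leT_wo.
have f1_tipped := min_gen_tipped le_adm K_gen leT_wo.
have f1_free := tipped_free f0_free ord_good f1_tipped.
have f0_uniform i : right_uniform (f0 i).
  split; first exact: (free_neq0 f0_free).
  by exists i.2; apply: (free_unit f0_free).
have f1_uniform i : right_uniform (f1 i).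
  split; first exact: (free_neq0 f1_free).
  by exists (terminus (val i).2); apply: (tipped_unit f1_tipped).
have f1_reduced : right_tip_reduced (base_ord le leT) (range f1 `|` range f1')%classic.
  move=> _ _ b b' [[j _ <-]|[[]]] [[j' _ <-]|[[]]] jb j'b' b1 bb'; congr f1.
  apply: (tipped_red f1_tipped).
    rewrite -(ctip_uniq f0_free ord_good jb (tipped_tip f1_tipped j)).
    by rewrite -(ctip_uniq f0_free ord_good j'b' (tipped_tip f1_tipped j')).
  rewrite -(ctip_uniq f0_free ord_good jb (tipped_tip f1_tipped j)).
  by rewrite -(ctip_uniq f0_free ord_good j'b' (tipped_tip f1_tipped j')).
have no_sum (y : coprod f1') : y = 0 by apply: coprodP => -[].
have f1_inj (x : coprod f1) (y : coprod f1') : csum x + csum y = 0 -> x = 0 /\ y = 0.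
  rewrite (no_sum y) raddf0 addr0 => x0; split=> //.
  exact: (csum_eq0 f0_free ord_good f1_tipped).
have f1_exact z : ppi z = 0 <->
    exists (x : coprod f1) (y : coprod f1'), z = csum x + csum y.
  apply: iff_trans (min_gen_span le_adm K_gen leT_wo z) _.
  split=> [[x ->]|[x [y ->]]]; first by exists x, 0; rewrite raddf0 addr0.
  by exists x; rewrite (no_sum y) raddf0 addr0.
have f1'_uniform (j : void) : right_uniform (f1' j) by case: j.
have f1'_I (j : void) : f1' j \in coprodI_pred f0 I by case: j.
exists (@AdmPres k Q le I M _ leT leT_wo f0 f0_uniform _ _ f1 f1' f1_uniform f1'_uniform
  f1'_I f1_reduced ppi ppi_surj f1_inj f1_exact); split.
- exists snd, (fun j => match j with inl i => terminus (val i).2 | inr x => of_void _ x end),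
    (fun j => match j with inl i => val i | inr x => of_void _ x end); split=> //=.
  + split=> [[j|[]]|[j|[]]|[j|[]] [j'|[]] jj' jj'2] /=.
    * exact: (tipped_tip f1_tipped).
    * exact: (tipped_unit f1_tipped).
    * by congr inl; apply: (tipped_red f1_tipped).
  (* Since [M] is a module over the quotient, [ppi] kills the coproduct of the [f_i I], and
     exactness gives the spanning clause. *)
  + by move=> w /(pi_coprodI ppi)/f1_exact.
- by exists (enum {: 'I_n * vertex Q}) => x; rewrite mem_enum.
- exact: (min_tips_finite le_adm K_gen leT_wo).
Qed.
End FirstStage.
End Stages.

Theorem proposition4p3 (k : fieldType) (Q : quiver) (I : ideal (palg k Q))
    (M : lmodType (quotring I)^c) (M_fp : fin_presented (restr M))
    (le : rel (qpath Q)) (le_adm : admissible_order le)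
    (I_fin : exists G0 : set (palg k Q), finite_set G0 /\ groebner_basis le I G0)
    (G : set (palg k Q)) (G_basis : groebner_basis le I G)
    (G_red : tip_reduced le G) (G_unif : forall g, G g -> uniform g) :
  exists P : admissible_presentation le M,
    projective_resolution (resd G P) (resaug G P) /\
    forall n, fin_gen (resL G P n).
Proof.
have [P [P_ok T0_fin T1_fin]] := presentation_ex le_adm M_fp.
exists P; have S_ok n : stage_ok le I (stages G P n).
  by elim: n => //= n IHn; apply: stage_ok_next.
have S_fin n : finitely_indexed (sT' (stages G P n)).
  elim: n => [|n IHn]; first exact: T1_fin.
  exact: (next_T_finite le_adm G_basis G_red I_fin (S_ok n)).
split; last first.
  move=> n; apply: coprod_mod_fin_gen.
  (* Level [0] is indexed by [T_0], while level [n.+1] is indexed by the new generators [sT'] of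
     stage [n]. *)
  by case: n => [|n]; [exact: T0_fin | exact: S_fin].
split.
- by move=> n; have [v f_free] := stage_ok_free (S_ok n); apply: coprod_mod_projective f_free.
- by move=> y; have [w wy] := @ppi_surj _ _ _ _ _ P y; exists (cpi I w); rewrite -wy; apply: caugE.
- exact: caug_exact (@pf1'_I _ _ _ _ _ P) (@pH_exact _ _ _ _ _ P).
- move=> n; apply: cdiff_exact => w.
  exact: (stage_ok_exact le_adm G_basis G_unif w (S_ok n)).
Qed.
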